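(* The $2$-category $\mathbf{PTor}_{\mathrm{SR}}$ of symmetrical rectangular pretorsion theories is $2$-equivalent, over $\mathbf{BiQPointCat}$, to the $2$-category $\mathbf{Ps}\text{-}M\text{-}\mathbf{Alg}$ of pseudo-algebras (and pseudo-morphisms between them) for the (strict) $2$-monad $$M\colon \mathbf{BiQPointCat}\to\mathbf{BiQPointCat},\qquad \mathbb C\mapsto \mathbb C\times\mathbb C,\quad G\mapsto G\times G,\quad \alpha\mapsto\alpha\times\alpha .$$
   Context: **Pretorsion theories.** A pretorsion theory is a triple $(\mathbb C,\mathcal T,\mathcal F)$ with $\mathbb C$ a category and $\mathcal T,\mathcal F$ full replete (closed under isomorphism) subcategories such that, putting $\mathcal Z=\mathcal T\cap\mathcal F$ and calling a morphism null if it factors through an object of $\mathcal Z$: (T1) every morphism from an object of $\mathcal T$ to an object of $\mathcal F$ is null; (T2) for every object $X$ there is a short exact sequence $T^X\xrightarrow{\ell^X}X\xrightarrow{r^X}F^X$ with $T^X\in\mathcal T$, $F^X\in\mathcal F$. Here a kernel of $f\colon X\to Y$ is a morphism $k\colon K\to X$ with $fk$ null such that every $u$ with $fu$ null factors uniquely through $k$; cokernels are dual; $(\ell,r)$ is short exact if $\ell$ is a kernel of $r$ and $r$ is a cokernel of $\ell$. Objects of $\mathcal T$ are called torsion, objects of $\mathcal F$ torsion-free. Pretorsion theories are assumed equipped with a choice of such a short exact sequence for each $X$, with $\ell^T=\mathrm{id}_T$ for $T\in\mathcal T$ and $r^F=\mathrm{id}_F$ for $F\in\mathcal F$. Each $h\colon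 X\to Y$ induces unique $h^T\colon T^X\to T^Y$, $h^F\colon F^X\to F^Y$ commuting with the $\ell$'s and $r$'s. The pretorsion theory is rectangular if $\Gamma\colon\mathbb C\to\mathcal T\times\mathcal F$, $X\mapsto(T^X,F^X)$, $h\mapsto(h^T,h^F)$, is an equivalence of categories. An equivalence of pretorsion theories is an equivalence of underlying categories preserving (in both directions) torsion and torsion-free objects. The product of two pretorsion theories is $(\mathbb C_1\times\mathbb C_2,\mathcal T_1\times\mathcal T_2,\mathcal F_1\times\mathcal F_2)$. **Bi-quasi-pointed categories.** A category is bi-quasi-pointed if it has an initial object $0$ and a terminal object $1$, and the unique morphism $0\to1$ is both a monomorphism and an epimorphism (equivalently, every morphism out of an initial object is mono and every morphism into a terminal object is epi). $\mathbf{BiQPointCat}$ is the $2$-category of bi-quasi-pointed categories, functors preserving $0$ and $1$, and natural transformations. **Symmetrical rectangular pretorsion theories.** A rectangular pretorsion theory is symmetrical if it is equivalent to a product of pretorsion theories $(\mathbb A,\mathbb A,\mathbf 1)$ and $(\mathbb B,\mathbf 0,\mathbb B)$ with $\mathbb A,\mathbb B$ bi-quasi-pointed, $\mathbf 1$ the full subcategory of terminal objects of $\mathbb A$ and $\mathbf 0$ the full subcategory of initial objects of $\mathbb B$. The underlying category of a symmetrical rectangular pretorsion theory is bi-quasi-pointed. $\mathbf{PTor}_{\mathrm{SR}}$ has these as objects; $1$-cells are functors between underlying categories that preserve torsion and torsion-free objects, send chosen short exact sequences to (not necessarily chosen) short exact sequences, and preserve $0$ and $1$; $2$-cells are natural transformations.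 The forgetful $2$-functor to $\mathbf{BiQPointCat}$ is $(\mathbb C,\mathcal T,\mathcal F)\mapsto\mathbb C$; ''over $\mathbf{BiQPointCat}$'' means compatibly with this and the usual forgetful $2$-functor from pseudo-algebras. **The 2-monad.** The unit of $M$ at $\mathbb C$ is the diagonal $\mathbb C\to\mathbb C\times\mathbb C$, and the multiplication at $\mathbb C$ is the projection $\pi_{1,4}\colon(\mathbb C\times\mathbb C)\times(\mathbb C\times\mathbb C)\to\mathbb C\times\mathbb C$ on the first and fourth components. Pseudo-algebras, pseudo-morphisms and their $2$-cells are the standard notions for a $2$-monad. *)

(* Defs.v *)
From Stdlib Require Import ssreflect ssrfun ClassicalEpsilon ProofIrrelevance
  FunctionalExtensionality Eqdep.

Set Implicit Arguments.
Unset Strict Implicit.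
Unset Printing Implicit Defensive.
Set Primitive Projections.

Declare Scope cat_scope.
Delimit Scope cat_scope with cat.
Local Open Scope cat_scope.

Record Category := {
  obj :> Type;
  hom : obj -> obj -> Type;
  idn : forall X, hom X X;
  cmp : forall X Y Z, hom Y Z -> hom X Y -> hom X Z;
  cmpA : forall X Y Z W (h : hom Z W) (g : hom Y Z) (f : hom X Y),
    cmp h (cmp g f) = cmp (cmp h g) f;
  cmp1f : forall X Y (f : hom X Y), cmp (idn Y) f = f;
  cmpf1 : forall X Y (f : hom X Y), cmp f (idn X) = f }.

Arguments hom {_} _ _.
Arguments idn {_} X.
Arguments cmp {_ X Y Z} g f : rename.

Notation "g ∘ f" := (cmp g f) (at level 40, left associativity) : cat_scope.

(* The set of all arrows.  [arr f = arr g] says that [f] and [g] are the same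
   arrow even when their sources (targets) are equal but not convertible; by
   [arr_inj] it is plain equality when they are parallel. *)
Record Arr (C : Category) := arr { adom : C; acod : C; aarr : hom adom acod }.
Arguments arr {C adom acod} aarr.

Lemma arr_inj (C : Category) (X Y : C) (f g : hom X Y) : arr f = arr g -> f = g.
Proof.
move=> e.
have e' : existT (fun a => {b : C & hom a b}) X (existT _ Y f)
        = existT (fun a => {b : C & hom a b}) X (existT _ Y g).
  exact: (f_equal (fun a : Arr C =>
    existT (fun a => {b : C & hom a b}) (adom a) (existT _ (acod a) (aarr a))) e).
exact: (inj_pair2 _ _ _ _ _ (inj_pair2 _ _ _ _ _ e')).
Qed.

Lemma arr_dom (C : Category) (X Y X' Y' : C) (f : hom X Y) (g : hom X' Y') :
  arr f = arr g -> X = X'.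
Proof. exact: (f_equal (@adom C)). Qed.

Lemma arr_cod (C : Category) (X Y X' Y' : C) (f : hom X Y) (g : hom X' Y') :
  arr f = arr g -> Y = Y'.
Proof. exact: (f_equal (@acod C)). Qed.

Definition eqcell (C : Category) (X Y : C) (p : X = Y) : hom X Y :=
  match p in _ = Y return hom X Y with eq_refl => idn X end.

(* Composite of two arrows that are composable only up to a (strict, but not
   definitional) equality of objects. *)
Definition vcomp (C : Category) (X Y Y' Z : C) (p : Y = Y')
    (f : hom X Y) (g : hom Y' Z) : hom X Z := g ∘ (eqcell p ∘ f).

Definition is_iso (C : Category) (X Y : C) (f : hom X Y) : Prop :=
  exists g : hom Y X, g ∘ f = idn X /\ f ∘ g = idn Y.

Definition mono (C : Category) (X Y : C) (f : hom X Y) : Prop :=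
  forall (Z : C) (u v : hom Z X), f ∘ u = f ∘ v -> u = v.

Definition epi (C : Category) (X Y : C) (f : hom X Y) : Prop :=
  forall (Z : C) (u v : hom Y Z), u ∘ f = v ∘ f -> u = v.

Definition initial (C : Category) (X : C) : Prop :=
  forall Y : C, exists! f : hom X Y, True.

Definition terminal (C : Category) (X : C) : Prop :=
  forall Y : C, exists! f : hom Y X, True.

Definition isomorphic (C : Category) (X Y : C) : Prop :=
  exists f : hom X Y, is_iso f.

Record Functor (C D : Category) := {
  fob :> C -> D;
  fmap : forall X Y : C, hom X Y -> hom (fob X) (fob Y);
  fmap1 : forall X, fmap (idn X) = idn (fob X);
  fmapM : forall X Y Z (g : hom Y Z) (f : hom X Y),
    fmap (g ∘ f) = fmap g ∘ fmap f }.
Arguments fmap {C D} F {X Y} f : rename.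

Record NatTrans (C D : Category) (F G : Functor C D) := {
  ntc :> forall X : C, hom (F X) (G X);
  ntP : forall (X Y : C) (f : hom X Y), ntc Y ∘ fmap F f = fmap G f ∘ ntc X }.

Lemma nt_eq (C D : Category) (F G : Functor C D) (s t : NatTrans F G) :
  (forall X, s X = t X) -> s = t.
Proof.
case: s t => [s hs] [t ht] /= e.
have {}e : s = t by apply: functional_extensionality_dep.
by subst t; f_equal; apply: proof_irrelevance.
Qed.

Lemma functor_eq (C D : Category) (F G : Functor C D) :
  (forall (X Y : C) (f : hom X Y), arr (fmap F f) = arr (fmap G f)) -> F = G.
Proof.
case: F G => [F Fm F1 FM] [G Gm G1 GM] /= e.
have eo : F = G.
  by apply: functional_extensionality => X; exact: arr_dom (e X X (idn X)).
subst G.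
have em : Fm = Gm.
  apply: functional_extensionality_dep => X.
  apply: functional_extensionality_dep => Y.
  by apply: functional_extensionality => f; apply: arr_inj.
by subst Gm; f_equal; apply: proof_irrelevance.
Qed.

Definition idF (C : Category) : Functor C C :=
  {| fob := fun X => X; fmap := fun _ _ f => f;
     fmap1 := fun _ => eq_refl; fmapM := fun _ _ _ _ _ => eq_refl |}.

Definition compF (C D E : Category) (G : Functor D E) (F : Functor C D) :
  Functor C E.
Proof.
refine {| fob := fun X => G (F X); fmap := fun _ _ f => fmap G (fmap F f) |}.
- abstract (by move=> X; rewrite !fmap1).
- abstract (by move=> X Y Z g f; rewrite !fmapM).
Defined.

Definition idNT (C D : Category) (F : Functor C D) : NatTrans F F.
Proof.
refine {| ntc := fun X => idn (F X) |}.
abstract (by move=> X Y f; rewrite cmp1f cmpf1).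
Defined.

Definition compNT (C D : Category) (F G H : Functor C D)
  (t : NatTrans G H) (s : NatTrans F G) : NatTrans F H.
Proof.
refine {| ntc := fun X => t X ∘ s X |}.
abstract (by move=> X Y f; rewrite -cmpA (ntP s) cmpA (ntP t) -cmpA).
Defined.

Definition hcompNT (C D E : Category) (G G' : Functor D E) (F F' : Functor C D)
  (t : NatTrans G G') (s : NatTrans F F') : NatTrans (compF G F) (compF G' F').
Proof.
refine {| ntc := fun X => (t (F' X) ∘ fmap G (s X)) : hom (compF G F X) (compF G' F' X) |}.
abstract (by move=> X Y f /=; rewrite -cmpA -fmapM (ntP s) fmapM cmpA (ntP t) -cmpA).
Defined.

Definition FunCat (C D : Category) : Category.
Proof.
refine {| obj := Functor C D; hom := @NatTrans C D;
          idn := @idNT C D; cmp := @compNT C D |}.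
- abstract (by move=> *; apply: nt_eq => X /=; rewrite cmpA).
- abstract (by move=> *; apply: nt_eq => X /=; rewrite cmp1f).
- abstract (by move=> *; apply: nt_eq => X /=; rewrite cmpf1).
Defined.

Definition nat_iso (C D : Category) (F G : Functor C D) : Prop :=
  exists t : NatTrans F G, forall X, is_iso (t X).

Definition is_equivalence (C D : Category) (F : Functor C D) : Prop :=
  exists G : Functor D C,
    nat_iso (compF G F) (idF C) /\ nat_iso (compF F G) (idF D).

(* Pairs with definitional eta. *)
Record pairp (A B : Type) := Pair { p1 : A; p2 : B }.
Arguments Pair {A B} _ _.
Notation "⟨ x , y ⟩" := (Pair x y) (format "⟨ x ,  y ⟩") : cat_scope.

Definition ProdCat (C D : Category) : Category.
Proof.
refine {| obj := pairp C D;
  hom := fun X Y => pairp (hom (p1 X) (p1 Y)) (hom (p2 X) (p2 Y));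
  idn := fun X => ⟨idn (p1 X), idn (p2 X)⟩;
  cmp := fun _ _ _ g f => ⟨p1 g ∘ p1 f, p2 g ∘ p2 f⟩ |}.
- abstract (by move=> * /=; rewrite !cmpA).
- abstract (by move=> * /=; rewrite !cmp1f).
- abstract (by move=> * /=; rewrite !cmpf1).
Defined.
Notation "C × D" := (ProdCat C D) (at level 40, no associativity) : cat_scope.

Definition prodF (C C' D D' : Category) (F : Functor C D) (G : Functor C' D') :
  Functor (C × C') (D × D').
Proof.
refine {| fob := fun X : C × C' => (⟨F (p1 X), G (p2 X)⟩ : D × D');
          fmap := fun _ _ f => ⟨fmap F (p1 f), fmap G (p2 f)⟩ |}.
- abstract (by move=> X /=; rewrite !fmap1).
- abstract (by move=> * /=; rewrite !fmapM).
Defined.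

Definition prodNT (C C' D D' : Category) (F F' : Functor C D)
  (G G' : Functor C' D') (s : NatTrans F F') (t : NatTrans G G') :
  NatTrans (prodF F G) (prodF F' G').
Proof.
refine {| ntc := fun X : C × C' =>
  (⟨s (p1 X), t (p2 X)⟩ : hom (prodF F G X) (prodF F' G' X)) |}.
abstract (by move=> * /=; rewrite (ntP s) (ntP t)).
Defined.

Definition diagF (C : Category) : Functor C (C × C).
Proof.
refine {| fob := fun X => (⟨X, X⟩ : C × C); fmap := fun _ _ f => ⟨f, f⟩ |}; done.
Defined.

Definition proj14 (C : Category) : Functor ((C × C) × (C × C)) (C × C).
Proof.
refine {| fob := fun X : (C × C) × (C × C) => (⟨p1 (p1 X), p2 (p2 X)⟩ : C × C);
          fmap := fun _ _ f => ⟨p1 (p1 f), p2 (p2 f)⟩ |}; done.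
Defined.

Record SubObj (C : Category) (P : C -> Prop) := MkSub { sub_ob : C; sub_in : P sub_ob }.
Arguments MkSub {C P} _ _.

Definition FullSub (C : Category) (P : C -> Prop) : Category :=
  {| obj := SubObj P;
     hom := fun X Y => hom (sub_ob X) (sub_ob Y);
     idn := fun X => idn (sub_ob X);
     cmp := fun _ _ _ g f => g ∘ f;
     cmpA := fun _ _ _ _ h g f => cmpA h g f;
     cmp1f := fun _ _ f => cmp1f f;
     cmpf1 := fun _ _ f => cmpf1 f |}.

Definition inclF (C : Category) (P : C -> Prop) : Functor (FullSub P) C :=
  {| fob := fun X : FullSub P => sub_ob X; fmap := fun _ _ f => f;
     fmap1 := fun _ => eq_refl; fmapM := fun _ _ _ _ _ => eq_refl |}.

Lemma arr_sub (C : Category) (P : C -> Prop) (X Y X' Y' : FullSub P)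
    (f : hom X Y) (g : hom X' Y') :
  @arr C (sub_ob X) (sub_ob Y) f = @arr C (sub_ob X') (sub_ob Y') g -> arr f = arr g.
Proof.
case: X Y X' Y' f g => [X hX] [Y hY] [X' hX'] [Y' hY'] /= f g e.
have eX := arr_dom e; have eY := arr_cod e; simpl in *; subst X' Y'.
have ef := arr_inj e; subst g.
by rewrite (proof_irrelevance _ hX' hX) (proof_irrelevance _ hY' hY).
Qed.

Lemma arr_nt (C D : Category) (F G F' G' : Functor C D)
    (s : NatTrans F G) (t : NatTrans F' G') :
  F = F' -> G = G' -> (forall X, arr (s X) = arr (t X)) ->
  @arr (FunCat C D) F G s = @arr (FunCat C D) F' G' t.
Proof.
move=> eF eG; subst F' G' => e.
by have -> : s = t by apply: nt_eq => X; apply: arr_inj.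
Qed.

(* Strict 2-categories.  The associativity and unit laws are equalities of
   2-cells as arrows of the hom-categories; on identity 2-cells they say that
   composition of 1-cells is strictly associative and unital. *)
Record TwoCat := {
  ob2 :> Type;
  hom2 : ob2 -> ob2 -> Category;
  id1 : forall A, hom2 A A;
  comp1 : forall A B C, hom2 B C -> hom2 A B -> hom2 A C;
  hcomp : forall A B C (g g' : hom2 B C) (f f' : hom2 A B),
    hom g g' -> hom f f' -> hom (comp1 g f) (comp1 g' f');
  hcomp1 : forall A B C (g : hom2 B C) (f : hom2 A B),
    hcomp (idn g) (idn f) = idn (comp1 g f);
  interchange : forall A B C (g g' g'' : hom2 B C) (f f' f'' : hom2 A B)
    (t' : hom g' g'') (t : hom g g') (s' : hom f' f'') (s : hom f f'),
    hcomp (t' ∘ t) (s' ∘ s) = hcomp t' s' ∘ hcomp t s;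
  hcompA : forall A B C D (h h' : hom2 C D) (g g' : hom2 B C) (f f' : hom2 A B)
    (u : hom h h') (t : hom g g') (s : hom f f'),
    arr (hcomp u (hcomp t s)) = arr (hcomp (hcomp u t) s);
  hcomp1f : forall A B (f f' : hom2 A B) (s : hom f f'),
    arr (hcomp (idn (id1 B)) s) = arr s;
  hcompf1 : forall A B (f f' : hom2 A B) (s : hom f f'),
    arr (hcomp s (idn (id1 A))) = arr s }.

Arguments hom2 {_} _ _.
Arguments id1 {_} A.
Arguments comp1 {_ A B C} g f : rename.
Arguments hcomp {_ A B C g g' f f'} t s : rename.

Notation "g ⊙ f" := (comp1 g f) (at level 40, left associativity) : cat_scope.
Notation "t ⋆ s" := (hcomp t s) (at level 40, left associativity) : cat_scope.
Notation "g ◁ s" := (hcomp (idn g) s) (at level 40, left associativity) : cat_scope.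
Notation "t ▷ f" := (hcomp t (idn f)) (at level 40, left associativity) : cat_scope.

Lemma comp1A (K : TwoCat) (A B C D : K) (h : hom2 C D) (g : hom2 B C)
  (f : hom2 A B) : h ⊙ (g ⊙ f) = (h ⊙ g) ⊙ f.
Proof. exact: arr_dom (hcompA (idn h) (idn g) (idn f)). Qed.

Lemma comp11f (K : TwoCat) (A B : K) (f : hom2 A B) : id1 B ⊙ f = f.
Proof. exact: arr_dom (hcomp1f (idn f)). Qed.

Lemma comp1f1 (K : TwoCat) (A B : K) (f : hom2 A B) : f ⊙ id1 A = f.
Proof. exact: arr_dom (hcompf1 (idn f)). Qed.

Record TwoFunctor (K L : TwoCat) := {
  f2ob :> K -> L;
  f2hom : forall A B : K, Functor (hom2 A B) (hom2 (f2ob A) (f2ob B));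
  f2id1 : forall A : K, f2hom A A (id1 A) = id1 (f2ob A);
  f2hcomp : forall (A B C : K) (g g' : hom2 B C) (f f' : hom2 A B)
    (t : hom g g') (s : hom f f'),
    arr (fmap (f2hom A C) (t ⋆ s)) = arr (fmap (f2hom B C) t ⋆ fmap (f2hom A B) s) }.
Arguments f2hom {K L} F {A B} : rename.

Notation "F @1 f" := (f2hom F f) (at level 30, no associativity) : cat_scope.
Notation "F @2 s" := (fmap (f2hom F) s) (at level 30, no associativity) : cat_scope.

Lemma f2comp1 (K L : TwoCat) (F : TwoFunctor K L) (A B C : K) (g : hom2 B C)
  (f : hom2 A B) : F @1 (g ⊙ f) = (F @1 g) ⊙ (F @1 f).
Proof. exact: arr_dom (f2hcomp F (idn g) (idn f)). Qed.

Lemma arr_fmap (C D : Category) (F : Functor C D) (X Y X' Y' : C)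
  (f : hom X Y) (g : hom X' Y') : arr f = arr g -> arr (fmap F f) = arr (fmap F g).
Proof. exact: (f_equal (fun a : Arr C => arr (fmap F (aarr a)))). Qed.

Definition id2F (K : TwoCat) : TwoFunctor K K :=
  {| f2ob := fun A => A; f2hom := fun A B => idF (hom2 A B);
     f2id1 := fun _ => eq_refl;
     f2hcomp := fun _ _ _ _ _ _ _ _ _ => eq_refl |}.

Definition comp2F (K L M : TwoCat) (G : TwoFunctor L M) (F : TwoFunctor K L) :
  TwoFunctor K M.
Proof.
refine {| f2ob := fun A => G (F A);
          f2hom := fun A B => compF (@f2hom _ _ G (F A) (F B)) (@f2hom _ _ F A B) |}.
- abstract (by move=> A /=; rewrite !f2id1).
- abstract (by move=> * /=; rewrite -f2hcomp; apply: arr_fmap; apply: f2hcomp).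
Defined.

(* The law at identity 2-cells is strict naturality in 1-cells, [tnP1]. *)
Record TwoNat (K L : TwoCat) (F G : TwoFunctor K L) := {
  tnc :> forall A : K, hom2 (F A) (G A);
  tnP : forall (A B : K) (f g : hom2 A B) (s : hom f g),
    arr (tnc B ◁ (F @2 s)) = arr ((G @2 s) ▷ tnc A) }.

Lemma tnP1 (K L : TwoCat) (F G : TwoFunctor K L) (t : TwoNat F G)
  (A B : K) (f : hom2 A B) : t B ⊙ (F @1 f) = (G @1 f) ⊙ t A.
Proof. exact: arr_dom (tnP t (idn f)). Qed.

Definition iso1 (K : TwoCat) (A B : K) (f : hom2 A B) : Prop :=
  exists g : hom2 B A, g ⊙ f = id1 A /\ f ⊙ g = id1 B.

Definition two_nat_iso (K L : TwoCat) (F G : TwoFunctor K L) (t : TwoNat F G) : Prop :=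
  forall A, iso1 (t A).

(* The set of all 1-cells, used to compare 1-cells whose endpoints are equal
   but not convertible. *)
Record Cell1 (K : TwoCat) := cell1 { c1dom : K; c1cod : K; c1cell : hom2 c1dom c1cod }.
Arguments cell1 {K c1dom c1cod} c1cell.

(* [X] and [Y], equipped with 2-functors [U] and [V] to [K], are 2-equivalent
   over [K]: the two 2-functors commute strictly with [U] and [V], and the
   2-natural isomorphisms lie over identities. *)
Definition two_equivalent_over (K X Y : TwoCat)
    (U : TwoFunctor X K) (V : TwoFunctor Y K) : Prop :=
  exists (F : TwoFunctor X Y) (G : TwoFunctor Y X)
         (h : TwoNat (id2F X) (comp2F G F)) (e : TwoNat (comp2F F G) (id2F Y)),
    comp2F V F = U /\ comp2F U G = V /\
    two_nat_iso h /\ two_nat_iso e /\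
    (forall A : X, cell1 (U @1 (h A)) = cell1 (id1 (U A))) /\
    (forall B : Y, cell1 (V @1 (e B)) = cell1 (id1 (V B))).

Definition CAT : TwoCat.
Proof.
refine {| ob2 := Category; hom2 := FunCat; id1 := idF;
          comp1 := (fun C D E G F => compF G F);
          hcomp := fun C D E G G' F F' t s => hcompNT t s |}.
- abstract (by move=> C D E G F; apply: nt_eq => X /=; rewrite fmap1 cmp1f).
- abstract (by move=> C D E G G' G'' F F' F'' t' t s' s; apply: nt_eq => X /=;
    rewrite fmapM -!cmpA; congr cmp; rewrite !cmpA ntP).
- abstract (by move=> A B C D H H' G G' F F' u t s; apply: arr_nt;
    try apply: functor_eq; move=> * //=; rewrite fmapM cmpA).
- abstract (by move=> A B F F' s; apply: arr_nt;
    try apply: functor_eq; move=> * //=; rewrite cmp1f).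
- abstract (by move=> A B F F' s; apply: arr_nt;
    try apply: functor_eq; move=> * //=; rewrite fmap1 cmpf1).
Defined.

(* Objects of [K] with extra structure, 1-cells of [K] satisfying a property,
   all 2-cells between them. *)
Section LocallyFull.
Variables (K : TwoCat) (X : Type) (U : X -> K).
Variable P : forall x y : X, hom2 (U x) (U y) -> Prop.
Hypothesis P1 : forall x, P (x:=x) (y:=x) (id1 (U x)).
Hypothesis PM : forall x y z (g : hom2 (U y) (U z)) (f : hom2 (U x) (U y)),
  P g -> P f -> P (x:=x) (y:=z) (g ⊙ f).

Definition LocallyFull : TwoCat.
Proof.
refine {| ob2 := X; hom2 := fun x y => FullSub (@P x y);
  id1 := fun x => (MkSub (id1 (U x)) (P1 x) : FullSub (@P x x));
  comp1 := fun x y z (g : FullSub (@P y z)) (f : FullSub (@P x y)) =>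
    (MkSub (sub_ob g ⊙ sub_ob f) (PM (sub_in g) (sub_in f)) : FullSub (@P x z));
  hcomp := fun x y z (g g' : FullSub (@P y z)) (f f' : FullSub (@P x y)) t s =>
    @hcomp K (U x) (U y) (U z) (sub_ob g) (sub_ob g') (sub_ob f) (sub_ob f') t s |}.
- abstract (by move=> *; apply: hcomp1).
- abstract (by move=> *; apply: interchange).
- abstract (by move=> *; apply: arr_sub; apply: hcompA).
- abstract (by move=> *; apply: arr_sub; apply: hcomp1f).
- abstract (by move=> *; apply: arr_sub; apply: hcompf1).
Defined.

Definition LocallyFull_forget : TwoFunctor LocallyFull K :=
  {| f2ob := U : LocallyFull -> K; f2hom := fun x y => inclF (@P x y);
     f2id1 := fun _ => eq_refl;
     f2hcomp := fun _ _ _ _ _ _ _ _ _ => eq_refl |}.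
End LocallyFull.

Record TwoMonad (K : TwoCat) := {
  mon :> TwoFunctor K K;
  mon_unit : TwoNat (id2F K) mon;
  mon_mult : TwoNat (comp2F mon mon) mon;
  mon_mul1T : forall A, mon_mult A ⊙ mon_unit (mon A) = id1 (mon A);
  mon_mulT1 : forall A, mon_mult A ⊙ (mon @1 mon_unit A) = id1 (mon A);
  mon_mulA : forall A,
    mon_mult A ⊙ mon_mult (mon A) = mon_mult A ⊙ (mon @1 mon_mult A) }.

(* Equalities of 1-cells used to paste 2-cells. *)
Lemma paste_sq (K : TwoCat) (A B B' C D : K) (x : hom2 C D)
    (p : hom2 B C) (q : hom2 A B) (r : hom2 B' C) (s : hom2 A B') :
  p ⊙ q = r ⊙ s -> (x ⊙ p) ⊙ q = (x ⊙ r) ⊙ s.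
Proof. by move=> e; rewrite -!comp1A e. Qed.

Lemma paste_F (K L : TwoCat) (F : TwoFunctor K L) (A B C : K) (D : L)
    (x : hom2 (F C) D) (g : hom2 B C) (f : hom2 A B) :
  x ⊙ (F @1 (g ⊙ f)) = (x ⊙ (F @1 g)) ⊙ (F @1 f).
Proof. by rewrite f2comp1 comp1A. Qed.

Arguments paste_F {K L} F {A B C D} x g f.

Section PseudoAlgebras.
Variables (K : TwoCat) (T : TwoMonad K).
Local Notation η := (mon_unit T).
Local Notation μ := (mon_mult T).

Record PsAlg := {
  pa_ob : K;
  pa_act : hom2 (T pa_ob) pa_ob;
  pa_unit : hom (id1 pa_ob) (pa_act ⊙ η pa_ob);
  pa_mult : hom (pa_act ⊙ (T @1 pa_act)) (pa_act ⊙ μ pa_ob);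
  pa_unit_iso : is_iso pa_unit;
  pa_mult_iso : is_iso pa_mult;
  pa_assoc :
    arr (vcomp (paste_sq pa_act (tnP1 μ pa_act) :
                 (pa_act ⊙ μ pa_ob) ⊙ (T @1 (T @1 pa_act))
                 = (pa_act ⊙ (T @1 pa_act)) ⊙ μ (T pa_ob))
           (pa_mult ▷ (T @1 (T @1 pa_act)))
           (pa_mult ▷ μ (T pa_ob)))
  = arr (vcomp (paste_F T pa_act pa_act (μ pa_ob))
           (pa_act ◁ (T @2 pa_mult))
           (pa_mult ▷ (T @1 μ pa_ob)));
  pa_unitl :
    arr (vcomp (paste_sq pa_act (tnP1 η pa_act) :
                 (pa_act ⊙ η pa_ob) ⊙ pa_act
                 = (pa_act ⊙ (T @1 pa_act)) ⊙ η (T pa_ob))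
           (pa_unit ▷ pa_act)
           (pa_mult ▷ η (T pa_ob)))
  = arr (idn pa_act);
  pa_unitr :
    arr (vcomp (paste_F T pa_act pa_act (η pa_ob))
           (pa_act ◁ (T @2 pa_unit))
           (pa_mult ▷ (T @1 η pa_ob)))
  = arr (idn pa_act) }.

Record PsMor (A B : PsAlg) := {
  pm_cell : hom2 (pa_ob A) (pa_ob B);
  pm_str : hom (pa_act B ⊙ (T @1 pm_cell)) (pm_cell ⊙ pa_act A);
  pm_str_iso : is_iso pm_str;
  pm_unit :
    arr (vcomp (paste_sq (pa_act B) (tnP1 η pm_cell) :
                 (pa_act B ⊙ η (pa_ob B)) ⊙ pm_cell
                 = (pa_act B ⊙ (T @1 pm_cell)) ⊙ η (pa_ob A))
           (pa_unit B ▷ pm_cell)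
           (pm_str ▷ η (pa_ob A)))
  = arr (pm_cell ◁ pa_unit A);
  pm_mult :
    arr (vcomp (paste_sq (pa_act B) (tnP1 μ pm_cell) :
                 (pa_act B ⊙ μ (pa_ob B)) ⊙ (T @1 (T @1 pm_cell))
                 = (pa_act B ⊙ (T @1 pm_cell)) ⊙ μ (pa_ob A))
           (pa_mult B ▷ (T @1 (T @1 pm_cell)))
           (pm_str ▷ μ (pa_ob A)))
  = arr (vcomp (esym (comp1A pm_cell (pa_act A) (T @1 pa_act A)))
           (vcomp (paste_F T (pa_act B) pm_cell (pa_act A))
              (pa_act B ◁ (T @2 pm_str))
              (pm_str ▷ (T @1 pa_act A)))
           (pm_cell ◁ pa_mult A)) }.

Definition pm_2cell (A B : PsAlg) (f g : PsMor A B)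
    (s : hom (pm_cell f) (pm_cell g)) : Prop :=
  (s ▷ pa_act A) ∘ pm_str f = pm_str g ∘ (pa_act B ◁ (T @2 s)).

Record PsCell (A B : PsAlg) (f g : PsMor A B) := MkPsCell {
  pc_cell : hom (pm_cell f) (pm_cell g);
  pc_coh : pm_2cell pc_cell }.

(* The proofs that pseudo-morphisms compose
   are carried out in the sets [Arr] of all 2-cells, where the strict laws are
   plain equalities; [tv x y] is junk unless [x] and [y] are composable. *)
Definition ti (C : Category) (X : C) : Arr C := arr (idn X).

Definition tv (C : Category) (x y : Arr C) : Arr C :=
  match excluded_middle_informative (acod x = adom y) with
  | left p => arr (vcomp p (aarr x) (aarr y))
  | right _ => x
  end.

Definition th (L : TwoCat) (A B C : L) (x : Arr (hom2 B C)) (y : Arr (hom2 A B)) :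
  Arr (hom2 A C) := arr (aarr x ⋆ aarr y).

Definition tF (L M : TwoCat) (F : TwoFunctor L M) (A B : L) (x : Arr (hom2 A B)) :
  Arr (hom2 (F A) (F B)) := arr (F @2 (aarr x)).

Lemma tvE (C : Category) (X Y Z : C) (f : hom X Y) (g : hom Y Z) :
  tv (arr f) (arr g) = arr (g ∘ f).
Proof.
rewrite /tv /=; case: excluded_middle_informative => [p|] //.
by rewrite (proof_irrelevance _ p eq_refl) /vcomp /= cmp1f.
Qed.

Lemma tv_vcomp (C : Category) (X Y Y' Z : C) (p : Y = Y') (f : hom X Y)
  (g : hom Y' Z) : arr (vcomp p f g) = tv (arr f) (arr g).
Proof. by subst Y'; rewrite tvE /vcomp /= cmp1f. Qed.

Lemma tv_dom (C : Category) (x y : Arr C) : adom (tv x y) = adom x.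
Proof. by rewrite /tv; case: excluded_middle_informative. Qed.

Lemma tv_cod (C : Category) (x y : Arr C) : acod x = adom y -> acod (tv x y) = acod y.
Proof. by rewrite /tv; case: excluded_middle_informative. Qed.

Lemma tvA (C : Category) (x y z : Arr C) : acod x = adom y -> acod y = adom z ->
  tv (tv x y) z = tv x (tv y z).
Proof.
case: x y z => [a b f] [b' c g] [c' d h] /= e e'; subst b' c'.
by rewrite !tvE cmpA.
Qed.

Lemma th_tv (L : TwoCat) (A B C : L) (x y : Arr (hom2 B C)) (z w : Arr (hom2 A B)) :
  acod x = adom y -> acod z = adom w ->
  th (tv x y) (tv z w) = tv (th x z) (th y w).
Proof.
case: x y z w => [a b f] [b' c g] [a1 b1 f1] [b1' c1 g1] /= e e'; subst b' b1'.
by rewrite !tvE /th /= interchange.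
Qed.

Lemma tv1x (C : Category) (X : C) (x : Arr C) : adom x = X -> tv (ti X) x = x.
Proof.
by case: x => [a b f] /= e; subst a; rewrite tvE cmpf1.
Qed.

Lemma tvx1 (C : Category) (X : C) (x : Arr C) : acod x = X -> tv x (ti X) = x.
Proof.
by case: x => [a b f] /= e; subst b; rewrite tvE cmp1f.
Qed.

Lemma thA (L : TwoCat) (A B C D : L) (x : Arr (hom2 C D)) (y : Arr (hom2 B C))
  (z : Arr (hom2 A B)) : th x (th y z) = th (th x y) z.
Proof. exact: hcompA. Qed.

Lemma th11 (L : TwoCat) (A B C : L) (g : hom2 B C) (f : hom2 A B) :
  th (ti g) (ti f) = ti (g ⊙ f).
Proof. by rewrite /th /= hcomp1. Qed.

Lemma tiE (C : Category) (X : C) : arr (idn X) = ti X.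
Proof. by []. Qed.

Lemma whlE (L : TwoCat) (A B C : L) (g : hom2 B C) (f f' : hom2 A B)
  (s : hom f f') : arr (g ◁ s) = th (ti g) (arr s).
Proof. by []. Qed.

Lemma whrE (L : TwoCat) (A B C : L) (g g' : hom2 B C) (f : hom2 A B)
  (t : hom g g') : arr (t ▷ f) = th (arr t) (ti f).
Proof. by []. Qed.

Lemma thE (L : TwoCat) (A B C : L) (g g' : hom2 B C) (f f' : hom2 A B)
  (t : hom g g') (s : hom f f') : arr (t ⋆ s) = th (arr t) (arr s).
Proof. by []. Qed.

Lemma tFE (L M : TwoCat) (F : TwoFunctor L M) (A B : L) (f f' : hom2 A B)
  (s : hom f f') : arr (F @2 s) = tF F (arr s).
Proof. by []. Qed.

Lemma tF1 (L M : TwoCat) (F : TwoFunctor L M) (A B : L) (f : hom2 A B) :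
  tF F (ti f) = ti (F @1 f).
Proof. by rewrite /tF /= fmap1. Qed.

Lemma tF_th (L M : TwoCat) (F : TwoFunctor L M) (A B C : L) (x : Arr (hom2 B C))
  (y : Arr (hom2 A B)) : tF F (th x y) = th (tF F x) (tF F y).
Proof. exact: f2hcomp. Qed.

Lemma tF_tv (L M : TwoCat) (F : TwoFunctor L M) (A B : L) (x y : Arr (hom2 A B)) :
  acod x = adom y -> tF F (tv x y) = tv (tF F x) (tF F y).
Proof.
case: x y => [a b f] [b' c g] /= e; subst b'.
by rewrite !tvE /tF /= fmapM.
Qed.

Lemma tv_whr (L : TwoCat) (A B C : L) (x y : Arr (hom2 B C)) (f : hom2 A B) :
  acod x = adom y ->
  th (tv x y) (ti f) = tv (th x (ti f)) (th y (ti f)).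
Proof. by move=> e; rewrite -th_tv // tv1x. Qed.

Lemma tv_whl (L : TwoCat) (A B C : L) (g : hom2 B C) (x y : Arr (hom2 A B)) :
  acod x = adom y ->
  th (ti g) (tv x y) = tv (th (ti g) x) (th (ti g) y).
Proof. by move=> e; rewrite -th_tv // tv1x. Qed.

Lemma th_slide (L : TwoCat) (A B C : L) (x : Arr (hom2 B C)) (y : Arr (hom2 A B)) :
  tv (th x (ti (adom y))) (th (ti (acod x)) y)
  = tv (th (ti (adom x)) y) (th x (ti (acod y))).
Proof. by rewrite -!th_tv //= !(tv1x, tvx1). Qed.

Lemma th1x (L : TwoCat) (A B : L) (x : Arr (hom2 A B)) :
  th (ti (id1 B)) x = x.
Proof. exact: hcomp1f. Qed.

Lemma thx1 (L : TwoCat) (A B : L) (x : Arr (hom2 A B)) :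
  th x (ti (id1 A)) = x.
Proof. exact: hcompf1. Qed.

Lemma thη (A B : K) (x : Arr (hom2 A B)) :
  th (ti (η B)) x = th (tF T x) (ti (η A)).
Proof. exact: (tnP η). Qed.

Lemma iso_cmp (C : Category) (X Y Z : C) (g : hom Y Z) (f : hom X Y) :
  is_iso g -> is_iso f -> is_iso (g ∘ f).
Proof.
move=> [g' [g1 g2]] [f' [f1 f2]]; exists (f' ∘ g'); split.
- by rewrite -cmpA (cmpA g') g1 cmp1f.
- by rewrite -cmpA (cmpA f) f2 cmp1f.
Qed.

Lemma iso_idn (C : Category) (X : C) : is_iso (idn X).
Proof. by exists (idn X); rewrite cmp1f. Qed.

Lemma iso_vcomp (C : Category) (X Y Y' Z : C) (p : Y = Y') (f : hom X Y)
  (g : hom Y' Z) : is_iso f -> is_iso g -> is_iso (vcomp p f g).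
Proof.
move=> hf hg; apply: iso_cmp => //; apply: iso_cmp => //.
by subst Y'; apply: iso_idn.
Qed.

Lemma iso_fmap (C D : Category) (F : Functor C D) (X Y : C) (f : hom X Y) :
  is_iso f -> is_iso (fmap F f).
Proof. by move=> [g [h1 h2]]; exists (fmap F g); rewrite -!fmapM h1 h2 !fmap1. Qed.

Lemma iso_hcomp (L : TwoCat) (A B C : L) (g g' : hom2 B C) (f f' : hom2 A B)
  (t : hom g g') (s : hom f f') : is_iso t -> is_iso s -> is_iso (t ⋆ s).
Proof.
move=> [t' [t1 t2]] [s' [s1 s2]]; exists (t' ⋆ s').
by rewrite -!interchange t1 t2 s1 s2 !hcomp1.
Qed.

Definition id_str (A : PsAlg) :
  hom (pa_act A ⊙ (T @1 id1 (pa_ob A))) (id1 (pa_ob A) ⊙ pa_act A) :=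
  eqcell (eq_trans (f_equal (comp1 (pa_act A)) (f2id1 T (pa_ob A)))
            (eq_trans (comp1f1 (pa_act A)) (esym (comp11f (pa_act A))))).

Definition comp_str (A B C : PsAlg) (g : PsMor B C) (f : PsMor A B) :
  hom (pa_act C ⊙ (T @1 (pm_cell g ⊙ pm_cell f)))
      ((pm_cell g ⊙ pm_cell f) ⊙ pa_act A) :=
  eqcell (comp1A (pm_cell g) (pm_cell f) (pa_act A)) ∘
  vcomp (esym (comp1A (pm_cell g) (pa_act B) (T @1 pm_cell f)))
    ((pm_str g ▷ (T @1 pm_cell f)) ∘ eqcell (paste_F T (pa_act C) (pm_cell g) (pm_cell f)))
    (pm_cell g ◁ pm_str f).

Lemma thμ (A B : K) (x : Arr (hom2 A B)) :
  th (ti (μ B)) (tF T (tF T x)) = th (tF T x) (ti (μ A)).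
Proof. exact: (tnP μ (aarr x)). Qed.

Lemma arr_eqcell (C : Category) (X Y : C) (p : X = Y) : arr (eqcell p) = ti X.
Proof. by subst Y. Qed.

Lemma arr_eql (C : Category) (X Y Z : C) (p : Y = Z) (f : hom X Y) :
  arr (eqcell p ∘ f) = arr f.
Proof. by subst Z; rewrite /= cmp1f. Qed.

Lemma arr_eqr (C : Category) (X Y Z : C) (p : X = Y) (f : hom Y Z) :
  arr (f ∘ eqcell p) = arr f.
Proof. by subst Y; rewrite /= cmpf1. Qed.

Lemma iso_eqcell (C : Category) (X Y : C) (p : X = Y) : is_iso (eqcell p).
Proof. by subst Y; apply: iso_idn. Qed.

Lemma arr_comp_str (A B C : PsAlg) (g : PsMor B C) (f : PsMor A B) :
  arr (comp_str g f) = tv (th (arr (pm_str g)) (ti (T @1 pm_cell f)))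
                          (th (ti (pm_cell g)) (arr (pm_str f))).
Proof. by rewrite /comp_str arr_eql tv_vcomp arr_eqr. Qed.

Lemma id_unit (A : PsAlg) :
  arr (vcomp (paste_sq (pa_act A) (tnP1 η (id1 (pa_ob A))))
         (pa_unit A ▷ id1 (pa_ob A)) (id_str A ▷ η (pa_ob A)))
  = arr (id1 (pa_ob A) ◁ pa_unit A).
Proof.
rewrite tv_vcomp !(whlE, whrE) arr_eqcell th11 thx1 th1x tvx1 //=.
by rewrite f2id1 comp1f1.
Qed.

Lemma id_mult (A : PsAlg) :
  arr (vcomp (paste_sq (pa_act A) (tnP1 μ (id1 (pa_ob A))))
         (pa_mult A ▷ (T @1 (T @1 id1 (pa_ob A)))) (id_str A ▷ μ (pa_ob A)))
  = arr (vcomp (esym (comp1A (id1 (pa_ob A)) (pa_act A) (T @1 pa_act A)))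
           (vcomp (paste_F T (pa_act A) (id1 (pa_ob A)) (pa_act A))
              (pa_act A ◁ (T @2 id_str A))
              (id_str A ▷ (T @1 pa_act A)))
           (id1 (pa_ob A) ◁ pa_mult A)).
Proof.
rewrite !tv_vcomp !(whlE, whrE) tFE !arr_eqcell tF1 !th11 th1x !f2id1 !thx1.
by rewrite tvx1 ?tv1x //= ?tv_dom /= ?f2comp1 ?f2id1 ?comp1f1 ?comp11f.
Qed.

Definition idPs (A : PsAlg) : PsMor A A :=
  {| pm_cell := id1 (pa_ob A); pm_str := id_str A;
     pm_str_iso := iso_eqcell _;
     pm_unit := id_unit A; pm_mult := id_mult A |}.

Lemma nηx (X Y Z : K) (x : hom2 (T Y) Z) (h : hom2 X Y) :
  x ⊙ η Y ⊙ h = x ⊙ (T @1 h) ⊙ η X.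
Proof. exact: paste_sq (tnP1 η h). Qed.

Lemma nμx (X Y Z : K) (x : hom2 (T Y) Z) (h : hom2 X Y) :
  x ⊙ μ Y ⊙ (T @1 (T @1 h)) = x ⊙ (T @1 h) ⊙ μ X.
Proof. exact: paste_sq (tnP1 μ h). Qed.

Ltac cells := rewrite /= ?tv_dom /=;
  repeat (rewrite tv_cod; [solve [cells] | rewrite /=]);
  rewrite ?f2comp1 ?comp1A ?nηx ?nμx //.

Lemma tv_swap (D : Category) (a b c d e c' b' : Arr D) :
  acod a = adom b -> acod b = adom c -> acod c = adom d -> acod d = adom e ->
  acod a = adom c' -> acod c' = adom b' -> acod b' = adom d ->
  tv b c = tv c' b' ->
  tv (tv a b) (tv (tv c d) e) = tv (tv (tv a c') (tv b' d)) e.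
Proof.
move=> h1 h2 h3 h4 h5 h6 h7 h.
have hc : acod (tv a c') = acod c' by apply: tv_cod.
have hb : acod (tv b' d) = acod d by apply: tv_cod; congruence.
rewrite (tvA h3 h4) (tvA (x := a)) ?tv_dom // -(tvA (x := b)) ?tv_dom // h.
by rewrite (tvA (x := c')) ?tv_dom // (tvA (x := tv a c')) ?tv_dom ?hc ?hb //
  (tvA (x := a)) ?tv_dom // (tvA (x := b')).
Qed.

Section Comp.
Variables (A B C : PsAlg) (g : PsMor B C) (f : PsMor A B).

Lemma comp_str_iso : is_iso (comp_str g f).
Proof.
apply: iso_cmp (iso_eqcell _) _; apply: iso_vcomp.
- apply: iso_cmp (iso_eqcell _); apply: iso_hcomp (iso_idn _); exact: pm_str_iso.
- by apply: iso_hcomp (iso_idn _) _; exact: pm_str_iso.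
Qed.

Lemma comp_unit :
  arr (vcomp (paste_sq (pa_act C) (tnP1 η (pm_cell g ⊙ pm_cell f)))
         (pa_unit C ▷ (pm_cell g ⊙ pm_cell f)) (comp_str g f ▷ η (pa_ob A)))
  = arr (pm_cell g ⊙ pm_cell f ◁ pa_unit A).
Proof.
have := pm_unit f; have := pm_unit g; rewrite !tv_vcomp !(whlE, whrE) => ug uf.
rewrite arr_comp_str tv_whr /=; first by rewrite comp1A.
rewrite -!th11 -(thA (arr (pm_str g))) -(tF1 T) -thη !thA.
rewrite -(thA _ (arr (pm_str f))).
rewrite -tvA /=; [by rewrite nηx | by rewrite !comp1A nηx |].
rewrite -tv_whr /=; first by rewrite nηx.
rewrite ug -!thA -uf tv_whl //=.
by rewrite nηx.
Qed.

Lemma comp_mult :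
  arr (vcomp (paste_sq (pa_act C) (tnP1 μ (pm_cell g ⊙ pm_cell f)))
         (pa_mult C ▷ (T @1 (T @1 (pm_cell g ⊙ pm_cell f))))
         (comp_str g f ▷ μ (pa_ob A)))
  = arr (vcomp (esym (comp1A (pm_cell g ⊙ pm_cell f) (pa_act A) (T @1 pa_act A)))
           (vcomp (paste_F T (pa_act C) (pm_cell g ⊙ pm_cell f) (pa_act A))
              (pa_act C ◁ (T @2 comp_str g f))
              (comp_str g f ▷ (T @1 pa_act A)))
           (pm_cell g ⊙ pm_cell f ◁ pa_mult A)).
Proof.
have := pm_mult f; have := pm_mult g; rewrite !tv_vcomp !(whlE, whrE) !tFE => mg mf.
rewrite arr_comp_str tF_tv /=; first by cells.
rewrite !tF_th !tF1 -!th11.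
rewrite !tv_whr /=; [by cells | by cells |].
rewrite tv_whl /=; first by cells.
set θg := arr (pm_str g); set θf := arr (pm_str f).
have -> : ti (T @1 (T @1 (pm_cell g ⊙ pm_cell f)))
   = th (ti (T @1 (T @1 pm_cell g))) (ti (T @1 (T @1 pm_cell f))).
  by rewrite -!tF1 -!tF_th th11.
rewrite -(thA θg) -(tF1 T (pm_cell f)) -thμ tF1 tF1 !thA.
rewrite -(thA _ θf (ti (μ _))).
rewrite -tvA /=; [by cells | by cells |].
rewrite -tv_whr /=; first by cells.
rewrite mg.
rewrite !tv_whr /=; [by cells | by cells |].
rewrite -(thA _ (arr (pa_mult B))).
rewrite tvA /=; [by cells | by cells |].
rewrite -tv_whl /=; first by cells.
rewrite mf.
rewrite -/θg -/θf tv_whl; first by cells.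
rewrite tv_whl; first by cells.
rewrite !thA; apply: tv_swap; try by cells.
have := th_slide θg (tF T θf); rewrite /= !th11 -!thA !th11 !f2comp1.
exact.
Qed.

Definition compPs : PsMor A C :=
  {| pm_cell := pm_cell g ⊙ pm_cell f; pm_str := comp_str g f;
     pm_str_iso := comp_str_iso; pm_unit := comp_unit; pm_mult := comp_mult |}.
End Comp.

Lemma pc_eq (A B : PsAlg) (f g : PsMor A B) (s t : PsCell f g) :
  pc_cell s = pc_cell t -> s = t.
Proof. by case: s t => [s hs] [t ht] /= e; subst t; f_equal; apply: proof_irrelevance. Qed.

Lemma pm_eq (A B : PsAlg) (f g : PsMor A B) :
  pm_cell f = pm_cell g -> arr (pm_str f) = arr (pm_str g) -> f = g.
Proof.
case: f g => [f s si su sm] [g t ti tu tm] /= e; subst g => e.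
by have e' := arr_inj e; subst t; f_equal; apply: proof_irrelevance.
Qed.

Lemma pm_2cell_idn (A B : PsAlg) (f : PsMor A B) :
  pm_2cell (f:=f) (g:=f) (idn (pm_cell f)).
Proof. by rewrite /pm_2cell fmap1 !hcomp1 cmp1f cmpf1. Qed.

Lemma pm_2cell_cmp (A B : PsAlg) (f g h : PsMor A B)
    (t : hom (pm_cell g) (pm_cell h)) (s : hom (pm_cell f) (pm_cell g)) :
  pm_2cell t -> pm_2cell s -> pm_2cell (t ∘ s).
Proof.
rewrite /pm_2cell => ht hs.
rewrite fmapM -(cmp1f (idn (pa_act A))) -(cmp1f (idn (pa_act B))) !interchange.
by rewrite -cmpA hs cmpA ht cmpA.
Qed.

Definition PsHom (A B : PsAlg) : Category.
Proof.
refine {| obj := PsMor A B; hom := @PsCell A B;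
          idn := fun f => MkPsCell (pm_2cell_idn f);
          cmp := fun f g h t s => MkPsCell (pm_2cell_cmp (pc_coh t) (pc_coh s)) |}.
- abstract (by move=> *; apply: pc_eq; apply: cmpA).
- abstract (by move=> *; apply: pc_eq; apply: cmp1f).
- abstract (by move=> *; apply: pc_eq; apply: cmpf1).
Defined.

Lemma arr_pc (A B : PsAlg) (f g f' g' : PsHom A B) (s : hom f g) (t : hom f' g') :
  f = f' -> g = g' -> arr (pc_cell s) = arr (pc_cell t) -> arr s = arr t.
Proof.
move=> ef eg; subst f' g' => e.
by have -> : s = t by apply: pc_eq; apply: arr_inj.
Qed.

Lemma pm_2cell_hcomp (A B C : PsAlg) (g g' : PsMor B C) (f f' : PsMor A B)
    (t : hom (pm_cell g) (pm_cell g')) (s : hom (pm_cell f) (pm_cell f')) :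
  pm_2cell t -> pm_2cell s ->
  pm_2cell (f := compPs g f) (g := compPs g' f') (t ⋆ s).
Proof.
rewrite /pm_2cell => ht hs; apply: arr_inj.
rewrite -[X in X = _]tvE -[X in _ = X]tvE !(whlE, whrE) !tFE !thE tF_th /= !arr_comp_str.
have et := f_equal (@arr _ _ _) ht; have es := f_equal (@arr _ _ _) hs.
rewrite -[X in X = _]tvE -[X in _ = X]tvE !(whlE, whrE) !tFE in et.
rewrite -[X in X = _]tvE -[X in _ = X]tvE !(whlE, whrE) !tFE in es.
have e1 : tv (th (ti (pm_cell g)) (arr (pm_str f)))
             (th (th (arr t) (arr s)) (ti (pa_act A)))
  = tv (th (th (arr t) (ti (pa_act B))) (tF T (arr s)))
       (th (ti (pm_cell g')) (arr (pm_str f'))).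
  rewrite -!thA -!th_tv //=.
  by rewrite tv1x // tvx1 // es.
have e2 : tv (th (arr (pm_str g)) (ti (T @1 pm_cell f)))
             (th (th (arr t) (ti (pa_act B))) (tF T (arr s)))
  = tv (th (ti (pa_act C)) (th (tF T (arr t)) (tF T (arr s))))
       (th (arr (pm_str g')) (ti (T @1 pm_cell f'))).
  by rewrite thA -!th_tv //= tv1x // tvx1 // et.
rewrite tvA; [by cells | by cells |].
rewrite e1 -tvA; [by cells | by cells |].
rewrite e2 tvA; by cells.
Qed.

Lemma compPsA (A B C D : PsAlg) (h : PsMor C D) (g : PsMor B C) (f : PsMor A B) :
  compPs h (compPs g f) = compPs (compPs h g) f.
Proof.
apply: pm_eq; [exact: comp1A |].
rewrite (arr_comp_str h (compPs g f)) (arr_comp_str (compPs h g) f) !arr_comp_str.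
rewrite tv_whl; first by cells.
rewrite tv_whr; first by cells.
have -> : ti (T @1 pm_cell (compPs g f))
   = th (ti (T @1 pm_cell g)) (ti (T @1 pm_cell f)) by rewrite th11 /= f2comp1.
by rewrite !thA th11 tvA; cells.
Qed.

Lemma compPs1f (A B : PsAlg) (f : PsMor A B) : compPs (idPs B) f = f.
Proof.
apply: pm_eq; [exact: comp11f |].
rewrite (arr_comp_str (idPs B) f) /= arr_eqcell th1x th11 tv1x //=.
by rewrite f2id1 comp1f1.
Qed.

Lemma compPsf1 (A B : PsAlg) (f : PsMor A B) : compPs f (idPs A) = f.
Proof.
apply: pm_eq; [exact: comp1f1 |].
rewrite (arr_comp_str f (idPs A)) /= arr_eqcell th11.
by rewrite f2id1 thx1 tvx1 //= comp1f1.
Qed.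

Definition PsAlgCat : TwoCat.
Proof.
refine {| ob2 := PsAlg; hom2 := PsHom; id1 := idPs; comp1 := compPs;
  hcomp := fun A B C g g' f f' t s =>
    (MkPsCell (pm_2cell_hcomp (pc_coh t) (pc_coh s))
      : hom (compPs g f : PsHom A C) (compPs g' f')) |}.
- abstract (by move=> A B C g f; apply: pc_eq; apply: hcomp1).
- abstract (by move=> *; apply: pc_eq; apply: interchange).
- abstract (by move=> A B C D h h' g g' f f' u t s;
    apply: arr_pc; try apply: compPsA; apply: hcompA).
- abstract (by move=> A B f f' s; apply: arr_pc; try apply: compPs1f; apply: hcomp1f).
- abstract (by move=> A B f f' s; apply: arr_pc; try apply: compPsf1; apply: hcompf1).
Defined.

Definition PsForget : TwoFunctor PsAlgCat K.
Proof.
unshelve refine {| f2ob := pa_ob : PsAlgCat -> K;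
  f2hom := fun A B => {| fob := @pm_cell A B : PsHom A B -> hom2 (pa_ob A) (pa_ob B);
                         fmap := fun f g s => pc_cell s |} |}; done.
Defined.
End PseudoAlgebras.

Definition biqpointed (C : Category) : Prop :=
  exists X0 X1 : C, initial X0 /\ terminal X1 /\
    forall f : hom X0 X1, mono f /\ epi f.

Record BiQP := { bq_cat :> Category; bq_prop : biqpointed bq_cat }.

Definition preserves01 (C D : Category) (F : Functor C D) : Prop :=
  (forall X, initial X -> initial (F X)) /\ (forall X, terminal X -> terminal (F X)).

Lemma preserves01_id (C : Category) : preserves01 (idF C).
Proof. by []. Qed.

Lemma preserves01_comp (C D E : Category) (G : Functor D E) (F : Functor C D) :
  preserves01 G -> preserves01 F -> preserves01 (compF G F).
Proof. by move=> [g0 g1] [f0 f1]; split=> X h; [apply/g0/f0 | apply/g1/f1]. Qed.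

Definition BiQPointCat : TwoCat :=
  @LocallyFull CAT BiQP bq_cat (fun C D F => @preserves01 C D F)
    (fun C => preserves01_id C) (fun C D E G F => @preserves01_comp C D E G F).

Definition BiQP_hom (C D : BiQPointCat) (F : Functor (bq_cat C) (bq_cat D))
  (h : preserves01 F) : hom2 C D := @MkSub (FunCat _ _) _ F h.

Lemma initial_hom (C : Category) (X Y : C) : initial X -> exists f : hom X Y, True.
Proof. by move=> h; have [f _] := h Y; exists f. Qed.

Lemma initial_uniq (C : Category) (X Y : C) (f g : hom X Y) : initial X -> f = g.
Proof. by move=> h; have [k [_ u]] := h Y; rewrite -(u f I) (u g I). Qed.

Lemma terminal_hom (C : Category) (X Y : C) : terminal X -> exists f : hom Y X, True.
Proof. by move=> h; have [f _] := h Y; exists f. Qed.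

Lemma terminal_uniq (C : Category) (X Y : C) (f g : hom Y X) : terminal X -> f = g.
Proof. by move=> h; have [k [_ u]] := h Y; rewrite -(u f I) (u g I). Qed.

Lemma initialP (C : Category) (X : C) :
  (forall Y, exists f : hom X Y, True) -> (forall Y (f g : hom X Y), f = g) -> initial X.
Proof. by move=> e u Y; have [f _] := e Y; exists f; split=> // g _; apply: u. Qed.

Lemma terminalP (C : Category) (X : C) :
  (forall Y, exists f : hom Y X, True) -> (forall Y (f g : hom Y X), f = g) -> terminal X.
Proof. by move=> e u Y; have [f _] := e Y; exists f; split=> // g _; apply: u. Qed.

Lemma initial_prod (C D : Category) (X : C × D) :
  initial X <-> initial (p1 X) /\ initial (p2 X).
Proof.
split.
- move=> h; split; apply: initialP.
  + by move=> Y; have [f _] := h ⟨Y, p2 X⟩; exists (p1 f).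
  + move=> Y f g; have e : (⟨f, idn (p2 X)⟩ : hom X ⟨Y, p2 X⟩) = ⟨g, idn (p2 X)⟩.
      exact: initial_uniq.
    exact: (f_equal (@p1 _ _) e).
  + by move=> Y; have [f _] := h ⟨p1 X, Y⟩; exists (p2 f).
  + move=> Y f g; have e : (⟨idn (p1 X), f⟩ : hom X ⟨p1 X, Y⟩) = ⟨idn (p1 X), g⟩.
      exact: initial_uniq.
    exact: (f_equal (@p2 _ _) e).
- move=> [h1 h2]; apply: initialP.
  + move=> Y; have [f _] := h1 (p1 Y); have [g _] := h2 (p2 Y).
    by exists (⟨f, g⟩ : hom X Y).
  + move=> Y [f1 f2] [g1 g2].
    by rewrite (initial_uniq f1 g1 h1) (initial_uniq f2 g2 h2).
Qed.

Lemma terminal_prod (C D : Category) (X : C × D) :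
  terminal X <-> terminal (p1 X) /\ terminal (p2 X).
Proof.
split.
- move=> h; split; apply: terminalP.
  + by move=> Y; have [f _] := h ⟨Y, p2 X⟩; exists (p1 f).
  + move=> Y f g; have e : (⟨f, idn (p2 X)⟩ : hom (⟨Y, p2 X⟩ : C × D) X) = ⟨g, idn (p2 X)⟩.
      exact: terminal_uniq.
    exact: (f_equal (@p1 _ _) e).
  + by move=> Y; have [f _] := h ⟨p1 X, Y⟩; exists (p2 f).
  + move=> Y f g; have e : (⟨idn (p1 X), f⟩ : hom (⟨p1 X, Y⟩ : C × D) X) = ⟨idn (p1 X), g⟩.
      exact: terminal_uniq.
    exact: (f_equal (@p2 _ _) e).
- move=> [h1 h2]; apply: terminalP.
  + move=> Y; have [f _] := h1 (p1 Y); have [g _] := h2 (p2 Y).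
    by exists (⟨f, g⟩ : hom Y X).
  + move=> Y [f1 f2] [g1 g2].
    by rewrite (terminal_uniq f1 g1 h1) (terminal_uniq f2 g2 h2).
Qed.

Lemma biqpointed_prod (C D : Category) :
  biqpointed C -> biqpointed D -> biqpointed (C × D).
Proof.
move=> [X0 [X1 [i [t h]]]] [Y0 [Y1 [i' [t' h']]]].
exists ⟨X0, Y0⟩, ⟨X1, Y1⟩; split; [|split].
- by apply/initial_prod.
- by apply/terminal_prod.
- move=> [f g]; have [m e] := h f; have [m' e'] := h' g; split.
  + move=> Z [u1 u2] [v1 v2] /= q.
    by rewrite (m _ _ _ (f_equal (@p1 _ _) q)) (m' _ _ _ (f_equal (@p2 _ _) q)).
  + move=> Z [u1 u2] [v1 v2] /= q.
    by rewrite (e _ _ _ (f_equal (@p1 _ _) q)) (e' _ _ _ (f_equal (@p2 _ _) q)).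
Qed.

Lemma preserves01_prodF (C C' D D' : Category) (F : Functor C D) (G : Functor C' D') :
  preserves01 F -> preserves01 G -> preserves01 (prodF F G).
Proof.
move=> [f0 f1] [g0 g1]; split=> X.
- by move=> /initial_prod [h1 h2]; apply/initial_prod; split; [apply: f0 | apply: g0].
- by move=> /terminal_prod [h1 h2]; apply/terminal_prod; split; [apply: f1 | apply: g1].
Qed.

Lemma preserves01_diag (C : Category) : preserves01 (diagF C).
Proof. by split=> X h; [apply/initial_prod | apply/terminal_prod]. Qed.

Lemma preserves01_proj14 (C : Category) : preserves01 (proj14 C).
Proof.
split=> X.
- by move=> /initial_prod [/initial_prod [h1 h2] /initial_prod [h3 h4]];
    apply/initial_prod.
- by move=> /terminal_prod [/terminal_prod [h1 h2] /terminal_prod [h3 h4]];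
    apply/terminal_prod.
Qed.

Definition M_ob (C : BiQPointCat) : BiQPointCat :=
  {| bq_cat := C × C; bq_prop := biqpointed_prod (bq_prop C) (bq_prop C) |}.

Definition M_hom (C D : BiQPointCat) : Functor (hom2 C D) (hom2 (M_ob C) (M_ob D)).
Proof.
refine {|
  fob := fun F : hom2 C D =>
    @BiQP_hom (M_ob C) (M_ob D) (prodF (sub_ob F) (sub_ob F))
       (preserves01_prodF (sub_in F) (sub_in F));
  fmap := fun (F G : hom2 C D) (s : hom F G) => prodNT s s |}.
- abstract (by move=> F; apply: nt_eq).
- abstract (by move=> F G H t s; apply: nt_eq).
Defined.

Definition M : TwoFunctor BiQPointCat BiQPointCat.
Proof.
refine {| f2ob := M_ob; f2hom := M_hom |}.
- abstract (by move=> C; apply: (arr_dom (f := idn _) (g := idn _)); apply: arr_sub;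
    apply: arr_nt; try apply: functor_eq).
- abstract (by move=> C D E G G' F F' t s; apply: arr_sub;
    apply: arr_nt; try apply: functor_eq).
Defined.

Definition M_unit : TwoNat (id2F BiQPointCat) M.
Proof.
refine {| tnc := fun C : BiQPointCat =>
  @BiQP_hom C (M C) (diagF (bq_cat C)) (preserves01_diag _)
  : hom2 (id2F BiQPointCat C) (M C) |}.
abstract (by move=> C D F G s; apply: arr_sub; apply: arr_nt; try apply: functor_eq;
  move=> * //=; rewrite ?fmap1 ?cmp1f ?cmpf1).
Defined.

Definition M_mult : TwoNat (comp2F M M) M.
Proof.
refine {| tnc := fun C =>
  @BiQP_hom (M (M C)) (M C) (proj14 (bq_cat C)) (preserves01_proj14 _)
  : hom2 (comp2F M M C) (M C) |}.
abstract (by move=> C D F G s; apply: arr_sub; apply: arr_nt; try apply: functor_eq;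
  move=> * //=; rewrite ?fmap1 ?cmp1f ?cmpf1).
Defined.

Lemma sub_eq (C : Category) (P : C -> Prop) (X Y : SubObj P) :
  sub_ob X = sub_ob Y -> X = Y.
Proof.
by case: X Y => [X hX] [Y hY] /= e; subst Y; f_equal; apply: proof_irrelevance.
Qed.

Definition M_monad : TwoMonad BiQPointCat.
Proof.
refine {| mon := M; mon_unit := M_unit; mon_mult := M_mult |};
abstract (by move=> C; apply: sub_eq; apply: functor_eq).
Defined.

Record Triple := {
  tcat :> Category;
  tors : tcat -> Prop;
  tfree : tcat -> Prop }.
Arguments tors {_} X.
Arguments tfree {_} X.

Section Exactness.
Variable P : Triple.

Definition null (X Y : P) (f : hom X Y) : Prop :=
  exists (Z : P) (g : hom X Z) (h : hom Z Y), tors Z /\ tfree Z /\ f = h ∘ g.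

Definition is_kernel (K X Y : P) (k : hom K X) (f : hom X Y) : Prop :=
  null (f ∘ k) /\
  forall (W : P) (u : hom W X), null (f ∘ u) -> exists! v : hom W K, k ∘ v = u.

Definition is_cokernel (X Y C : P) (c : hom Y C) (f : hom X Y) : Prop :=
  null (c ∘ f) /\
  forall (W : P) (u : hom Y W), null (u ∘ f) -> exists! v : hom C W, v ∘ c = u.

Definition short_exact (A X B : P) (l : hom A X) (r : hom X B) : Prop :=
  is_kernel l r /\ is_cokernel r l.
End Exactness.

Definition replete (C : Category) (Q : C -> Prop) : Prop :=
  forall X Y : C, isomorphic X Y -> Q X -> Q Y.

(* [ell X : tors_ob X -> X] and [rho X : X -> tfree_ob X] form the chosen short
   exact sequence.  [ell_id] states both T^X = X and l^X = id for torsion X,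
   and dually for [rho_id]. *)
Record Pretorsion := {
  pt :> Triple;
  tors_replete : replete (@tors pt);
  tfree_replete : replete (@tfree pt);
  pt_null : forall (X Y : pt) (f : hom X Y), tors X -> tfree Y -> null f;
  tors_ob : pt -> pt;
  tfree_ob : pt -> pt;
  tors_obP : forall X, tors (tors_ob X);
  tfree_obP : forall X, tfree (tfree_ob X);
  ell : forall X, hom (tors_ob X) X;
  rho : forall X, hom X (tfree_ob X);
  pt_exact : forall X, short_exact (ell X) (rho X);
  ell_id : forall X, tors X -> arr (ell X) = arr (idn X);
  rho_id : forall X, tfree X -> arr (rho X) = arr (idn X) }.

Section Gamma.
Variable P : Pretorsion.

Lemma ind_T_ex (X Y : P) (h : hom X Y) :
  exists! k : hom (tors_ob X) (tors_ob Y), ell Y ∘ k = h ∘ ell X.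
Proof.
have [[_ u] _] := pt_exact Y; apply: u.
exact: pt_null (tors_obP X) (tfree_obP Y).
Qed.

Lemma ind_F_ex (X Y : P) (h : hom X Y) :
  exists! k : hom (tfree_ob X) (tfree_ob Y), k ∘ rho X = rho Y ∘ h.
Proof.
have [_ [_ u]] := pt_exact X; apply: u.
exact: pt_null (tors_obP X) (tfree_obP Y).
Qed.

Definition ind_T (X Y : P) (h : hom X Y) : hom (tors_ob X) (tors_ob Y) :=
  proj1_sig (constructive_definite_description _ (ind_T_ex h)).

Definition ind_F (X Y : P) (h : hom X Y) : hom (tfree_ob X) (tfree_ob Y) :=
  proj1_sig (constructive_definite_description _ (ind_F_ex h)).

Lemma ind_TP (X Y : P) (h : hom X Y) : ell Y ∘ ind_T h = h ∘ ell X.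
Proof. exact: proj2_sig (constructive_definite_description _ (ind_T_ex h)). Qed.

Lemma ind_FP (X Y : P) (h : hom X Y) : ind_F h ∘ rho X = rho Y ∘ h.
Proof. exact: proj2_sig (constructive_definite_description _ (ind_F_ex h)). Qed.

Lemma ind_T_uniq (X Y : P) (h : hom X Y) (k : hom (tors_ob X) (tors_ob Y)) :
  ell Y ∘ k = h ∘ ell X -> ind_T h = k.
Proof.
by move=> e; have [v [_ u]] := ind_T_ex h; rewrite -(u _ e) -(u _ (ind_TP h)).
Qed.

Lemma ind_F_uniq (X Y : P) (h : hom X Y) (k : hom (tfree_ob X) (tfree_ob Y)) :
  k ∘ rho X = rho Y ∘ h -> ind_F h = k.
Proof.
by move=> e; have [v [_ u]] := ind_F_ex h; rewrite -(u _ e) -(u _ (ind_FP h)).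
Qed.

Definition Gamma : Functor P (FullSub (@tors P) × FullSub (@tfree P)).
Proof.
refine {|
  fob := fun X : P => (⟨MkSub (tors_ob X) (tors_obP X), MkSub (tfree_ob X) (tfree_obP X)⟩ :
                       FullSub (@tors P) × FullSub (@tfree P));
  fmap := fun X Y h => ⟨ind_T h, ind_F h⟩ |}.
- abstract (by move=> X; congr Pair; [apply: ind_T_uniq | apply: ind_F_uniq];
    rewrite cmp1f cmpf1).
- abstract (by move=> X Y Z g f; congr Pair; [apply: ind_T_uniq | apply: ind_F_uniq];
    rewrite /= ?cmpA ?ind_TP -?cmpA ?ind_TP ?ind_FP ?cmpA ?ind_FP).
Defined.

Definition rectangular : Prop := is_equivalence Gamma.
End Gamma.

Definition prodTriple (P Q : Triple) : Triple :=
  {| tcat := P × Q;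
     tors := fun X : P × Q => tors (p1 X) /\ tors (p2 X);
     tfree := fun X : P × Q => tfree (p1 X) /\ tfree (p2 X) |}.

Definition all_torsion (A : Category) : Triple :=
  {| tcat := A; tors := fun _ => True; tfree := @terminal A |}.

Definition all_tfree (B : Category) : Triple :=
  {| tcat := B; tors := @initial B; tfree := fun _ => True |}.

(* Depends only on the underlying triples: an equivalence need not respect the
   chosen short exact sequences. *)
Definition pt_equivalent (P Q : Triple) : Prop :=
  exists (E : Functor P Q) (E' : Functor Q P),
    nat_iso (compF E' E) (idF P) /\ nat_iso (compF E E') (idF Q) /\
    (forall X, tors X -> tors (E X)) /\ (forall X, tfree X -> tfree (E X)) /\
    (forall Y, tors Y -> tors (E' Y)) /\ (forall Y, tfree Y -> tfree (E' Y)).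

Definition symmetrical (P : Triple) : Prop :=
  exists A B : Category, biqpointed A /\ biqpointed B /\
    pt_equivalent P (prodTriple (all_torsion A) (all_tfree B)).

Record SRPretorsion := {
  sr :> Pretorsion;
  sr_rectangular : rectangular sr;
  sr_symmetrical : symmetrical sr }.

Lemma faithful_of_equiv (C D : Category) (E : Functor C D) (E' : Functor D C) :
  nat_iso (compF E' E) (idF C) ->
  forall (X Y : C) (f g : hom X Y), fmap E f = fmap E g -> f = g.
Proof.
move=> [t ti] X Y f g e; have [s [_ h2]] := ti X.
have ef := ntP t f; have eg := ntP t g; simpl in *.
by rewrite -(cmpf1 f) -(cmpf1 g) -h2 !cmpA -ef -eg e.
Qed.

Lemma equiv_initial (C D : Category) (E : Functor C D) (E' : Functor D C) (d : D) :
  nat_iso (compF E' E) (idF C) -> nat_iso (compF E E') (idF D) ->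
  initial d -> initial (E' d).
Proof.
move=> n1 [s si] hd; apply: initialP.
- move=> X; have [t _] := n1; have [f _] := hd (E X).
  by exists (t X ∘ fmap E' f).
- move=> X f g; apply: (faithful_of_equiv n1).
  have [k [h1 h2]] := si d; simpl in *.
  rewrite -(cmpf1 (fmap E f)) -(cmpf1 (fmap E g)) -h1 !cmpA; congr cmp.
  exact: initial_uniq.
Qed.

Lemma equiv_terminal (C D : Category) (E : Functor C D) (E' : Functor D C) (d : D) :
  nat_iso (compF E' E) (idF C) -> nat_iso (compF E E') (idF D) ->
  terminal d -> terminal (E' d).
Proof.
move=> n1 [s si] hd; apply: terminalP.
- move=> X; have [t ti] := n1; have [f _] := hd (E X); have [k _] := ti X.
  by exists (fmap E' f ∘ k).
- move=> X f g; apply: (faithful_of_equiv n1).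
  have [k [h1 h2]] := si d; simpl in *.
  rewrite -(cmp1f (fmap E f)) -(cmp1f (fmap E g)) -h1 -!cmpA; congr cmp.
  exact: terminal_uniq.
Qed.

Lemma biqpointed_any (C : Category) : biqpointed C ->
  forall (X Y : C) (f : hom X Y), initial X -> terminal Y -> mono f /\ epi f.
Proof.
move=> [X0 [X1 [i [t h]]]] X Y f hX hY.
have [a _] := hX X0; have [b _] := i X; have [c _] := hY X1; have [d _] := t Y.
have [m e] := h (d ∘ f ∘ b); split.
- move=> Z u v euv.
  have eu : b ∘ (a ∘ u) = u by rewrite cmpA (initial_uniq (b ∘ a) (idn X)) ?cmp1f.
  have ev : b ∘ (a ∘ v) = v by rewrite cmpA (initial_uniq (b ∘ a) (idn X)) ?cmp1f.
  rewrite -eu -ev; congr cmp; apply: m.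
  by rewrite -!cmpA eu ev euv.
- move=> Z u v euv.
  have eu : (u ∘ c) ∘ d = u by rewrite -cmpA (terminal_uniq (c ∘ d) (idn Y)) ?cmpf1.
  have ev : (v ∘ c) ∘ d = v by rewrite -cmpA (terminal_uniq (c ∘ d) (idn Y)) ?cmpf1.
  rewrite -eu -ev; congr cmp; apply: e.
  by rewrite !cmpA eu ev euv.
Qed.

Lemma biqpointed_equiv (C D : Category) (E : Functor C D) (E' : Functor D C) :
  nat_iso (compF E' E) (idF C) -> nat_iso (compF E E') (idF D) ->
  biqpointed D -> biqpointed C.
Proof.
move=> n1 n2 hD; have [d0 [d1 [i [t _]]]] := hD.
have hi := equiv_initial n1 n2 i; have ht := equiv_terminal n1 n2 t.
exists (E' d0), (E' d1); split=> //; split=> // f.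
have [m e] := biqpointed_any hD (fmap E f)
  (equiv_initial n2 n1 hi) (equiv_terminal n2 n1 ht).
by split=> Z u v q; apply: (faithful_of_equiv n1); [apply: m | apply: e];
  rewrite -!fmapM q.
Qed.

Lemma sr_biqpointed (P : SRPretorsion) : biqpointed P.
Proof.
have [A [B [hA [hB [E [E' [n1 [n2 _]]]]]]]] := sr_symmetrical P.
exact: biqpointed_equiv n1 n2 (biqpointed_prod hA hB).
Qed.

Definition sr_cat (P : SRPretorsion) : BiQPointCat :=
  {| bq_cat := P; bq_prop := sr_biqpointed P |}.

Definition pt_functor (P Q : Pretorsion) (G : Functor P Q) : Prop :=
  (forall X, tors X -> tors (G X)) /\
  (forall X, tfree X -> tfree (G X)) /\
  (forall X, short_exact (fmap G (ell X)) (fmap G (rho X))).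

Lemma kernel_mono (P : Triple) (K X Y : P) (k : hom K X) (f : hom X Y) :
  is_kernel k f -> mono k.
Proof.
move=> [h0 h] Z u v e.
have hn : null (f ∘ (k ∘ u)).
  rewrite cmpA; have [W [a [b [hT [hF ->]]]]] := h0.
  by exists W, (a ∘ u), b; rewrite cmpA.
have [w [_ hu]] := h _ _ hn.
by rewrite -(hu u erefl) -(hu v) // e.
Qed.

Lemma cokernel_epi (P : Triple) (X Y C : P) (c : hom Y C) (f : hom X Y) :
  is_cokernel c f -> epi c.
Proof.
move=> [h0 h] Z u v e.
have hn : null ((u ∘ c) ∘ f).
  rewrite -cmpA; have [W [a [b [hT [hF ->]]]]] := h0.
  by exists W, a, (u ∘ b); rewrite cmpA.
have [w [_ hu]] := h _ _ hn.
by rewrite -(hu u erefl) -(hu v) // e.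
Qed.

Lemma ses_unique (P : Pretorsion) (A X B : P) (l : hom A X) (r : hom X B) :
  tors A -> tfree B -> short_exact l r ->
  exists (i : hom A (tors_ob X)) (j : hom (tfree_ob X) B),
    is_iso i /\ is_iso j /\ ell X ∘ i = l /\ j ∘ rho X = r.
Proof.
move=> hA hB [hk hc]; have [hk' hc'] := pt_exact X.
have [_ k1] := hk; have [_ c1] := hc; have [_ k2] := hk'; have [_ c2] := hc'.
have [i [ei _]] := k2 _ l (pt_null _ hA (tfree_obP X)).
have [i' [ei' _]] := k1 _ (ell X) (pt_null _ (tors_obP X) hB).
have [j [ej _]] := c2 _ r (pt_null _ (tors_obP X) hB).
have [j' [ej' _]] := c1 _ (rho X) (pt_null _ hA (tfree_obP X)).
exists i, j; split; [|split; [|by []]].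
- exists i'; split.
  + by apply: (kernel_mono hk); rewrite cmpA ei' ei cmpf1.
  + by apply: (kernel_mono hk'); rewrite cmpA ei ei' cmpf1.
- exists j'; split.
  + by apply: (cokernel_epi hc'); rewrite -cmpA ej ej' cmp1f.
  + by apply: (cokernel_epi hc); rewrite -cmpA ej' ej cmp1f.
Qed.

Lemma null_l (P : Triple) (X Y Z : P) (g : hom Y Z) (f : hom X Y) : null f -> null (g ∘ f).
Proof.
by move=> [W [h [k [hT [hF ->]]]]]; exists W, h, (g ∘ k); rewrite cmpA.
Qed.

Lemma null_r (P : Triple) (X Y Z : P) (g : hom Y Z) (f : hom X Y) : null g -> null (g ∘ f).
Proof.
by move=> [W [h [k [hT [hF ->]]]]]; exists W, (h ∘ f), k; rewrite cmpA.
Qed.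

Lemma ses_iso (P : Triple) (A A' X B B' : P) (l : hom A X) (r : hom X B)
    (i : hom A' A) (j : hom B B') :
  is_iso i -> is_iso j -> short_exact l r -> short_exact (l ∘ i) (j ∘ r).
Proof.
move=> [i' [i1 i2]] [j' [j1 j2]] [hk hc].
have [n k] := hk; have [_ c] := hc.
have n' : null (j ∘ r ∘ (l ∘ i)).
  by rewrite -cmpA; apply: null_l; rewrite cmpA; apply: null_r.
split; split=> // W u hu.
- have {}hu : null (r ∘ u).
    by rewrite -(cmp1f r) -j1 -!cmpA; apply: null_l; rewrite cmpA.
  have [v [ev uv]] := k _ _ hu.
  exists (i' ∘ v); split.
    by rewrite -cmpA (cmpA i) i2 cmp1f.
  by move=> w ew; rewrite (uv (i ∘ w)) ?cmpA // i1 cmp1f.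
- have {}hu : null (u ∘ l).
    by rewrite -(cmpf1 l) -i2 !cmpA; apply: null_r; rewrite -cmpA.
  have [v [ev uv]] := c _ _ hu.
  exists (v ∘ j'); split.
    by rewrite -cmpA (cmpA j') j1 cmp1f.
  by move=> w ew; rewrite (uv (w ∘ j)) -?cmpA // j2 cmpf1.
Qed.

Lemma pt_functor_id (P : Pretorsion) : pt_functor (idF P).
Proof. by split=> //; split=> // X; apply: pt_exact. Qed.

Lemma pt_functor_comp (P Q R : Pretorsion) (G : Functor Q R) (F : Functor P Q) :
  pt_functor G -> pt_functor F -> pt_functor (compF G F).
Proof.
move=> [gT [gF gS]] [fT [fF fS]]; split; [|split].
- by move=> X h; apply/gT/fT.
- by move=> X h; apply/gF/fF.
- move=> X /=.
  have [i [j [hi [hj [<- <-]]]]] := ses_unique (fT _ (tors_obP X)) (fF _ (tfree_obP X)) (fS X).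
  by rewrite !fmapM; apply: ses_iso; [exact: iso_fmap | exact: iso_fmap | exact: gS].
Qed.

Definition PTorSR : TwoCat :=
  @LocallyFull BiQPointCat SRPretorsion sr_cat
    (fun P Q G => @pt_functor P Q (sub_ob G))
    (fun P => pt_functor_id P)
    (fun P Q R G F => @pt_functor_comp P Q R (sub_ob G) (sub_ob F)).

Definition PTorSR_forget : TwoFunctor PTorSR BiQPointCat :=
  @LocallyFull_forget BiQPointCat SRPretorsion sr_cat
    (fun P Q G => @pt_functor P Q (sub_ob G))
    (fun P => pt_functor_id P)
    (fun P Q R G F => @pt_functor_comp P Q R (sub_ob G) (sub_ob F)).

(* Main.v *)
From Stdlib Require Import ssreflect ssrfun ClassicalEpsilon ProofIrrelevance
  FunctionalExtensionality Eqdep.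
Require Import Defs.

(** Both structures on a bi-quasi-pointed category [C] amount to a splitting: an
    equivalence [C ≃ A × B] with [A] and [B] bi-quasi-pointed, where only the two
    classes of morphisms inverted by the projections [C -> A] and [C -> B] matter.
    Both kinds of 1-cells are the functors that preserve these two classes, and
    all natural transformations are 2-cells on either side.  Hence the
    2-functors in the two directions keep the underlying category, functor and
    natural transformation, all their laws hold because there is nothing but the
    underlying data to compare, and the two 2-natural isomorphisms are carried by
    identity functors, which preserve both classes.

    From a splitting, [split_alg] makes the pseudo-algebra whose action sends
    [(X, Y)] to the object with components [X] in [A] and [Y] in [B], and
    [split_sr] makes the pretorsion theory in which [X] is torsion if its
    component in [B] is initial and torsion-free if its component in [A] is
    terminal.  The short exact sequence of [X] is [(a, 0) -> (a, b) -> (1, b)];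
    that it is one uses that maps out of [0] are mono and maps into [1] are epi.

    Conversely, a symmetrical pretorsion theory has a splitting by definition
    ([symmetrical_splits]).  For a pseudo-algebra with action [⊗], take for [A]
    the image of [- ⊗ 0] and for [B] the image of [0 ⊗ -]
    ([band_splitting]).  As [(X ⊗ Y) ⊗ (Z ⊗ W) ≅ X ⊗ W], the functors [- ⊗ Z]
    for different [Z] identify and invert the same morphisms, and as
    [X ⊗ X ≅ X], a morphism [f] is recovered from [f ⊗ 0] and [0 ⊗ f].

    A functor [G] that preserves the two classes is a pseudo-morphism: the
    comparison [G X ⊗ G Y -> G (X ⊗ Y)] is assembled from the canonical maps
    [X ⊗ 0 -> X] and [0 ⊗ Y -> Y] ([bandmap_of_preserves]).  It is the only
    possible one, since compatibility with the unit fixes it on the diagonal and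
    naturality along [(X, X) <- (X, 0) -> (X, Y)] carries its component in [A] to
    all pairs, and dually for [B] ([bandmap_uniq]).  The same argument gives the
    multiplication axiom ([bandmap_mult]) and shows that every natural
    transformation is a 2-cell ([bandmap_2cell]).  On the other side,
    [pt_functor_splitting] and [splitting_pt_functor] characterize the functors
    of pretorsion theories, by uniqueness of short exact sequences. *)

Set Implicit Arguments.
Unset Strict Implicit.
Unset Printing Implicit Defensive.
Set Primitive Projections.
Local Open Scope cat_scope.

(** * Isomorphisms, initial and terminal objects *)

Section Isos.
Variable C : Category.

Lemma iso_mono (X Y : C) (f : hom X Y) : is_iso f -> mono f.
Proof.
by move=> [g [gf _]] Z u v e; rewrite -(cmp1f u) -(cmp1f v) -gf -!cmpA e.
Qed.

Lemma iso_epi (X Y : C) (f : hom X Y) : is_iso f -> epi f.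
Proof.
by move=> [g [_ fg]] Z u v e; rewrite -(cmpf1 u) -(cmpf1 v) -fg !cmpA e.
Qed.

Lemma iso_cancel_l (X Y Z : C) (g : hom Y Z) (f : hom X Y) :
  is_iso g -> is_iso (g ∘ f) -> is_iso f.
Proof.
move=> [g' [g1 g2]] gf.
have -> : f = g' ∘ (g ∘ f) by rewrite cmpA g1 cmp1f.
by apply: iso_cmp gf; exists g.
Qed.

Lemma iso_cancel_r (X Y Z : C) (g : hom Y Z) (f : hom X Y) :
  is_iso f -> is_iso (g ∘ f) -> is_iso g.
Proof.
move=> [f' [f1 f2]] gf.
have -> : g = g ∘ f ∘ f' by rewrite -cmpA f2 cmpf1.
by apply: iso_cmp gf _; exists f.
Qed.

Lemma initial_iso (X Y : C) (f : hom X Y) : initial X -> initial Y -> is_iso f.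
Proof.
move=> hX hY; have [g _] := initial_hom X hY.
by exists g; split; apply: initial_uniq.
Qed.

Lemma terminal_iso (X Y : C) (f : hom X Y) : terminal X -> terminal Y -> is_iso f.
Proof.
move=> hX hY; have [g _] := terminal_hom Y hX.
by exists g; split; apply: terminal_uniq.
Qed.

Lemma iso_initial (X Y : C) (f : hom X Y) : is_iso f -> initial X -> initial Y.
Proof.
move=> [g [_ fg]] hX; apply: initialP => Z.
- by have [k _] := initial_hom Z hX; exists (k ∘ g).
- move=> u v; rewrite -(cmpf1 u) -(cmpf1 v) -fg !cmpA; congr cmp.
  exact: initial_uniq.
Qed.

Lemma iso_terminal (X Y : C) (f : hom X Y) : is_iso f -> terminal X -> terminal Y.
Proof.
move=> [g [_ fg]] hX; apply: terminalP => Z.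
- by have [k _] := terminal_hom Z hX; exists (f ∘ k).
- move=> u v; rewrite -(cmp1f u) -(cmp1f v) -fg -!cmpA; congr cmp.
  exact: terminal_uniq.
Qed.

Lemma biqpointed_initial : biqpointed C -> exists X : C, initial X.
Proof. by move=> [X [_ [h _]]]; exists X. Qed.

Lemma biqpointed_terminal : biqpointed C -> exists X : C, terminal X.
Proof. by move=> [_ [X [_ [h _]]]]; exists X. Qed.

Lemma initial_mono (X Y : C) (f : hom X Y) : biqpointed C -> initial X -> mono f.
Proof.
move=> hC hX Z u v e; have [T hT] := biqpointed_terminal hC.
have [g _] := terminal_hom Y hT.
have [m _] := biqpointed_any hC (g ∘ f) hX hT.
by apply: m; rewrite -!cmpA e.
Qed.

Lemma terminal_epi (X Y : C) (f : hom X Y) : biqpointed C -> terminal Y -> epi f.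
Proof.
move=> hC hY Z u v e; have [I hI] := biqpointed_initial hC.
have [g _] := initial_hom X hI.
have [_ m] := biqpointed_any hC (f ∘ g) hI hY.
by apply: m; rewrite !cmpA e.
Qed.

(** The inverse is unique, so choosing it costs nothing; having it as a term
    lets inverses of natural isomorphisms be defined componentwise. *)
Definition inv (X Y : C) (f : hom X Y) (h : is_iso f) : hom Y X :=
  proj1_sig (constructive_indefinite_description _ h).

Lemma invK (X Y : C) (f : hom X Y) (h : is_iso f) : inv h ∘ f = idn X.
Proof. by rewrite /inv; case: constructive_indefinite_description => g []. Qed.

Lemma invKV (X Y : C) (f : hom X Y) (h : is_iso f) : f ∘ inv h = idn Y.
Proof. by rewrite /inv; case: constructive_indefinite_description => g []. Qed.

Lemma inv_iso (X Y : C) (f : hom X Y) (h : is_iso f) : is_iso (inv h).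
Proof. by exists f; rewrite invK invKV. Qed.

(** Turns a commuting square with two invertible sides around. *)
Lemma inv_square (X Y X' Y' : C) (f : hom X Y) (f' : hom X' Y')
    (h : is_iso f) (h' : is_iso f') (p : hom X X') (q : hom Y Y') :
  q ∘ f = f' ∘ p -> inv h' ∘ q = p ∘ inv h.
Proof.
move=> e; apply: (iso_epi h); rewrite -!cmpA e invK cmpf1.
by rewrite cmpA invK cmp1f.
Qed.

End Isos.

Lemma iso_pair (C D : Category) (X Y : C × D) (f : hom X Y) :
  is_iso (p1 f) -> is_iso (p2 f) -> is_iso f.
Proof.
move=> [g1 [a b]] [g2 [c d]]; exists (⟨g1, g2⟩ : hom Y X).
by split; rewrite /= ?a ?b ?c ?d.
Qed.

Lemma iso_p1 (C D : Category) (X Y : C × D) (f : hom X Y) : is_iso f -> is_iso (p1 f).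
Proof.
by move=> [g [a b]]; exists (p1 g); split;
  [exact: (f_equal (@p1 _ _) a) | exact: (f_equal (@p1 _ _) b)].
Qed.

Lemma iso_p2 (C D : Category) (X Y : C × D) (f : hom X Y) : is_iso f -> is_iso (p2 f).
Proof.
by move=> [g [a b]]; exists (p2 g); split;
  [exact: (f_equal (@p2 _ _) a) | exact: (f_equal (@p2 _ _) b)].
Qed.

(** * Equivalences of categories *)

Section Equivalences.
Variables (C D : Category) (E : Functor C D).

Lemma full_of_equiv (E' : Functor D C) :
  nat_iso (compF E' E) (idF C) -> nat_iso (compF E E') (idF D) ->
  forall (X Y : C) (g : hom (E X) (E Y)), exists f, fmap E f = g.
Proof.
move=> [t ti] n2 X Y g; exists (t Y ∘ fmap E' g ∘ inv (ti X)).
apply: (faithful_of_equiv n2); apply: (iso_mono (ti Y)).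
by have /= -> := ntP t (t Y ∘ fmap E' g ∘ inv (ti X)); rewrite -!cmpA invK cmpf1.
Qed.

Hypothesis full : forall (X Y : C) (g : hom (E X) (E Y)), exists f, fmap E f = g.
Hypothesis faithful : forall (X Y : C) (f g : hom X Y), fmap E f = fmap E g -> f = g.
Hypothesis eso : forall d : D, exists (X : C) (e : hom (E X) d), is_iso e.

Lemma reflect_iso (X Y : C) (f : hom X Y) : is_iso (fmap E f) -> is_iso f.
Proof.
move=> [g' [h1 h2]]; have [g eg] := full g'; exists g.
by split; apply: faithful; rewrite fmapM eg ?h1 ?h2 fmap1.
Qed.

Let eso_sig (d : D) : {X : C & {e : hom (E X) d | is_iso e}}.
Proof.
have [X /constructive_indefinite_description he] :=
  constructive_indefinite_description _ (eso d).
by exists X.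
Qed.

Let ob (d : D) : C := projT1 (eso_sig d).
Let ε (d : D) : hom (E (ob d)) d := proj1_sig (projT2 (eso_sig d)).
Let εi (d : D) : is_iso (ε d) := proj2_sig (projT2 (eso_sig d)).

Let mor (c d : D) (g : hom c d) : hom (ob c) (ob d) :=
  proj1_sig (constructive_indefinite_description _ (full (inv (εi d) ∘ g ∘ ε c))).

Let morP (c d : D) (g : hom c d) : ε d ∘ fmap E (mor g) = g ∘ ε c.
Proof.
rewrite /mor; case: constructive_indefinite_description => f /= ->.
by rewrite !cmpA invKV cmp1f.
Qed.

Let mor_uniq (c d : D) (g : hom c d) f : ε d ∘ fmap E f = g ∘ ε c -> mor g = f.
Proof. by move=> e; apply: faithful; apply: (iso_mono (εi d)); rewrite morP. Qed.

Lemma equiv_of_ff_eso : is_equivalence E.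
Proof.
have m1 : forall d, mor (idn d) = idn (ob d).
  by move=> d; apply: mor_uniq; rewrite fmap1 cmp1f cmpf1.
have mM : forall a b c (g : hom b c) (f : hom a b), mor (g ∘ f) = mor g ∘ mor f.
  by move=> a b c g f; apply: mor_uniq; rewrite fmapM cmpA morP -cmpA morP cmpA.
pose E' := {| fob := ob; fmap := mor; fmap1 := m1; fmapM := mM |}.
exists E'; split.
- pose t X := proj1_sig (constructive_indefinite_description _ (full (ε (E X)))).
  have tE : forall X, fmap E (t X) = ε (E X).
    by move=> X; rewrite /t; case: constructive_indefinite_description.
  have tN : forall X Y (f : hom X Y), t Y ∘ fmap (compF E' E) f = fmap (idF C) f ∘ t X.
    by move=> X Y f; apply: faithful; rewrite !fmapM !tE /= morP.
  exists {| ntc := t : forall X, hom (compF E' E X) (idF C X); ntP := tN |} => X /=.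
  by apply: reflect_iso; rewrite tE; apply: εi.
- exists {| ntc := ε : forall d, hom (compF E E' d) (idF D d); ntP := morP |} => d.
  exact: εi.
Qed.

End Equivalences.

(** * Splittings *)

(** An equivalence [C ≃ A × B] with [A] and [B] bi-quasi-pointed, stored as its
    two components: [spl1] and [spl2] are jointly fully faithful and jointly
    essentially surjective. *)
Record Splitting (C : Category) := {
  splA : Category;
  splB : Category;
  spl1 : Functor C splA;
  spl2 : Functor C splB;
  splA_bq : biqpointed splA;
  splB_bq : biqpointed splB;
  spl_faithful : forall (X Y : C) (f g : hom X Y),
    fmap spl1 f = fmap spl1 g -> fmap spl2 f = fmap spl2 g -> f = g;
  spl_full : forall (X Y : C) (a : hom (spl1 X) (spl1 Y)) (b : hom (spl2 X) (spl2 Y)),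
    exists f : hom X Y, fmap spl1 f = a /\ fmap spl2 f = b;
  spl_eso : forall (a : splA) (b : splB), exists (X : C)
    (e : hom (spl1 X) a) (e' : hom (spl2 X) b), is_iso e /\ is_iso e' }.

Section Splitting.
Variables (C : Category) (S : Splitting C).
Local Notation s1 := (spl1 S).
Local Notation s2 := (spl2 S).

Definition lift (X Y : C) (a : hom (s1 X) (s1 Y)) (b : hom (s2 X) (s2 Y)) : hom X Y :=
  proj1_sig (constructive_indefinite_description _ (spl_full a b)).

Lemma lift1 (X Y : C) (a : hom (s1 X) (s1 Y)) (b : hom (s2 X) (s2 Y)) :
  fmap s1 (lift a b) = a.
Proof. by rewrite /lift; case: constructive_indefinite_description => f []. Qed.

Lemma lift2 (X Y : C) (a : hom (s1 X) (s1 Y)) (b : hom (s2 X) (s2 Y)) :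
  fmap s2 (lift a b) = b.
Proof. by rewrite /lift; case: constructive_indefinite_description => f []. Qed.

Lemma spl_reflect_iso (X Y : C) (f : hom X Y) :
  is_iso (fmap s1 f) -> is_iso (fmap s2 f) -> is_iso f.
Proof.
move=> [g1 [a b]] [g2 [c d]]; exists (lift g1 g2).
by split; apply: (spl_faithful (s := S)); rewrite fmapM ?lift1 ?lift2 fmap1.
Qed.

Lemma lift_iso (X Y : C) (a : hom (s1 X) (s1 Y)) (b : hom (s2 X) (s2 Y)) :
  is_iso a -> is_iso b -> is_iso (lift a b).
Proof. by move=> ha hb; apply: spl_reflect_iso; rewrite ?lift1 ?lift2. Qed.

Lemma spl_initialI (X : C) : initial (s1 X) -> initial (s2 X) -> initial X.
Proof.
move=> h1 h2; apply: initialP => Y.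
- have [a _] := initial_hom (s1 Y) h1; have [b _] := initial_hom (s2 Y) h2.
  by exists (lift a b).
- by move=> f g; apply: (spl_faithful (s := S)); apply: initial_uniq.
Qed.

Lemma spl_terminalI (X : C) : terminal (s1 X) -> terminal (s2 X) -> terminal X.
Proof.
move=> h1 h2; apply: terminalP => Y.
- have [a _] := terminal_hom (s1 Y) h1; have [b _] := terminal_hom (s2 Y) h2.
  by exists (lift a b).
- by move=> f g; apply: (spl_faithful (s := S)); apply: terminal_uniq.
Qed.

Lemma spl_initial (X : C) : initial X -> initial (s1 X) /\ initial (s2 X).
Proof.
move=> hX; have [a ha] := biqpointed_initial (splA_bq S).
have [b hb] := biqpointed_initial (splB_bq S).
have [Y [e [e' [[k [h1 h2]] [k' [h1' h2']]]]]] := spl_eso a b.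
have hY1 : initial (s1 Y) by apply: (iso_initial (f := k)) ha; exists e.
have hY2 : initial (s2 Y) by apply: (iso_initial (f := k')) hb; exists e'.
have hY := spl_initialI hY1 hY2.
have [f _] := initial_hom X hY; have fi := initial_iso f hY hX.
by split; [apply: iso_initial (iso_fmap s1 fi) _ | apply: iso_initial (iso_fmap s2 fi) _].
Qed.

Lemma spl_terminal (X : C) : terminal X -> terminal (s1 X) /\ terminal (s2 X).
Proof.
move=> hX; have [a ha] := biqpointed_terminal (splA_bq S).
have [b hb] := biqpointed_terminal (splB_bq S).
have [Y [e [e' [[k [h1 h2]] [k' [h1' h2']]]]]] := spl_eso a b.
have hY1 : terminal (s1 Y) by apply: (iso_terminal (f := k)) ha; exists e.
have hY2 : terminal (s2 Y) by apply: (iso_terminal (f := k')) hb; exists e'.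
have hY := spl_terminalI hY1 hY2.
have [f _] := terminal_hom Y hX; have fi := terminal_iso f hY hX.
by split; [apply: iso_terminal (iso_fmap s1 fi) _ | apply: iso_terminal (iso_fmap s2 fi) _].
Qed.

End Splitting.

(** A functor between two categories with splittings descends to the factors
    [A] and [B], up to isomorphism, exactly if it preserves these two classes of
    morphisms. *)
Definition preserves_splitting (C D : Category) (S : Splitting C) (S' : Splitting D)
    (G : Functor C D) : Prop :=
  (forall (X Y : C) (f : hom X Y),
     is_iso (fmap (spl1 S) f) -> is_iso (fmap (spl1 S') (fmap G f))) /\
  (forall (X Y : C) (f : hom X Y),
     is_iso (fmap (spl2 S) f) -> is_iso (fmap (spl2 S') (fmap G f))).

(** * 2-cells of [BiQPointCat] *)

Lemma arr_2cell (C D : BiQPointCat) (F G F' G' : hom2 C D) (s : hom F G) (t : hom F' G') :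
  (forall X Y (f : hom X Y), arr (fmap (sub_ob F) f) = arr (fmap (sub_ob F') f)) ->
  (forall X Y (f : hom X Y), arr (fmap (sub_ob G) f) = arr (fmap (sub_ob G') f)) ->
  (forall X, arr (ntc s X) = arr (ntc t X)) -> arr s = arr t.
Proof. by move=> eF eG e; apply: arr_sub; apply: arr_nt => //; apply: functor_eq. Qed.

Lemma vcomp_ntc (C D : BiQPointCat) (F G G' H : hom2 C D) (p : G = G')
    (s : hom F G) (t : hom G' H) (X : bq_cat C) (a b c : bq_cat D)
    (f : hom a b) (g : hom b c) :
  arr (ntc s X) = arr f -> arr (ntc t X) = arr g ->
  arr (ntc (vcomp p s t) X) = arr (g ∘ f).
Proof.
subst G'; rewrite /vcomp /= cmp1f => e1 e2.
by rewrite -!tvE -e1 -e2 !tvE.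
Qed.

Lemma whr_ntc (C D E : BiQPointCat) (g g' : hom2 D E) (t : hom g g') (f : hom2 C D)
    (X : bq_cat C) : arr (ntc (t ▷ f) X) = arr (ntc t (sub_ob f X)).
Proof. by rewrite /= fmap1 cmpf1. Qed.

Lemma whl_ntc (C D E : BiQPointCat) (g : hom2 D E) (f f' : hom2 C D) (s : hom f f')
    (X : bq_cat C) : arr (ntc (g ◁ s) X) = arr (fmap (sub_ob g) (ntc s X)).
Proof. by rewrite /= cmp1f. Qed.

Lemma nt_is_iso (C D : BiQPointCat) (F G : hom2 C D) (s : hom F G) :
  (forall X, is_iso (ntc s X)) -> is_iso s.
Proof.
move=> h.
have N : forall X Y (f : hom X Y),
    inv (h Y) ∘ fmap (sub_ob G) f = fmap (sub_ob F) f ∘ inv (h X).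
  by move=> X Y f; apply: inv_square; rewrite ntP.
by exists {| ntc := fun X => inv (h X); ntP := N |}; split; apply: nt_eq => X /=;
  rewrite ?invK ?invKV.
Qed.

Lemma ntc_is_iso (C D : BiQPointCat) (F G : hom2 C D) (s : hom F G) (X : bq_cat C) :
  is_iso s -> is_iso (ntc s X).
Proof.
move=> [t [ts st]]; exists (ntc t X).
split; [exact: (f_equal (fun u : NatTrans _ _ => ntc u X) ts)
       | exact: (f_equal (fun u : NatTrans _ _ => ntc u X) st)].
Qed.

(** * The pseudo-algebra of a splitting *)

Section AlgOfSplitting.
Variables (C : BiQPointCat) (S : Splitting (bq_cat C)).
Local Notation K := (bq_cat C).
Local Notation s1 := (spl1 S).
Local Notation s2 := (spl2 S).

Lemma rect_exists (X Y : K) :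
  exists p : {Z : K & pairp (hom (s1 Z) (s1 X)) (hom (s2 Z) (s2 Y))},
    is_iso (p1 (projT2 p)) /\ is_iso (p2 (projT2 p)).
Proof.
by have [Z [e [e' h]]] := spl_eso (s1 X) (s2 Y); exists (existT _ Z ⟨e, e'⟩).
Qed.

Let rect_sig X Y := constructive_indefinite_description _ (rect_exists X Y).

Definition rect (X Y : K) : K := projT1 (proj1_sig (rect_sig X Y)).
Definition ε1 (X Y : K) : hom (s1 (rect X Y)) (s1 X) :=
  p1 (projT2 (proj1_sig (rect_sig X Y))).
Definition ε2 (X Y : K) : hom (s2 (rect X Y)) (s2 Y) :=
  p2 (projT2 (proj1_sig (rect_sig X Y))).

Lemma ε1_iso (X Y : K) : is_iso (ε1 X Y).
Proof. exact: (proj1 (proj2_sig (rect_sig X Y))). Qed.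

Lemma ε2_iso (X Y : K) : is_iso (ε2 X Y).
Proof. exact: (proj2 (proj2_sig (rect_sig X Y))). Qed.

(** All structure maps are maps into objects [rect X Y], and such a map is the
    same as an arbitrary pair of maps to [s1 X] and [s2 Y]; hence every equation
    of pseudo-algebras can be checked after composing with [ε1] and [ε2]. *)
Definition into (V X Y : K) (a : hom (s1 V) (s1 X)) (b : hom (s2 V) (s2 Y)) :
  hom V (rect X Y) := lift (inv (ε1_iso X Y) ∘ a) (inv (ε2_iso X Y) ∘ b).

Lemma into1 (V X Y : K) (a : hom (s1 V) (s1 X)) (b : hom (s2 V) (s2 Y)) :
  ε1 X Y ∘ fmap s1 (into a b) = a.
Proof. by rewrite lift1 cmpA invKV cmp1f. Qed.

Lemma into2 (V X Y : K) (a : hom (s1 V) (s1 X)) (b : hom (s2 V) (s2 Y)) :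
  ε2 X Y ∘ fmap s2 (into a b) = b.
Proof. by rewrite lift2 cmpA invKV cmp1f. Qed.

Lemma into_ext (V X Y : K) (f g : hom V (rect X Y)) :
  ε1 X Y ∘ fmap s1 f = ε1 X Y ∘ fmap s1 g ->
  ε2 X Y ∘ fmap s2 f = ε2 X Y ∘ fmap s2 g -> f = g.
Proof.
move=> /(iso_mono (ε1_iso _ _)) h1 /(iso_mono (ε2_iso _ _)) h2.
exact: spl_faithful h1 h2.
Qed.

Lemma into_iso (V X Y : K) (a : hom (s1 V) (s1 X)) (b : hom (s2 V) (s2 Y)) :
  is_iso a -> is_iso b -> is_iso (into a b).
Proof.
by move=> ha hb; apply: lift_iso; apply: iso_cmp => //; apply: inv_iso.
Qed.

Definition rect_map (X X' Y Y' : K) (f : hom X X') (g : hom Y Y') :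
  hom (rect X Y) (rect X' Y') := into (fmap s1 f ∘ ε1 X Y) (fmap s2 g ∘ ε2 X Y).

Definition rect_unit (X : K) : hom X (rect X X) := into (idn (s1 X)) (idn (s2 X)).

Definition rect_mult (X Y Z W : K) : hom (rect (rect X Y) (rect Z W)) (rect X W) :=
  into (ε1 X Y ∘ ε1 (rect X Y) (rect Z W)) (ε2 Z W ∘ ε2 (rect X Y) (rect Z W)).

Lemma rect_map1 (X X' Y Y' : K) (f : hom X X') (g : hom Y Y') :
  ε1 X' Y' ∘ fmap s1 (rect_map f g) = fmap s1 f ∘ ε1 X Y.
Proof. exact: into1. Qed.

Lemma rect_map2 (X X' Y Y' : K) (f : hom X X') (g : hom Y Y') :
  ε2 X' Y' ∘ fmap s2 (rect_map f g) = fmap s2 g ∘ ε2 X Y.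
Proof. exact: into2. Qed.

Lemma rect_unit1 (X : K) : ε1 X X ∘ fmap s1 (rect_unit X) = idn (s1 X).
Proof. exact: into1. Qed.

Lemma rect_unit2 (X : K) : ε2 X X ∘ fmap s2 (rect_unit X) = idn (s2 X).
Proof. exact: into2. Qed.

Lemma rect_mult1 (X Y Z W : K) :
  ε1 X W ∘ fmap s1 (rect_mult X Y Z W) = ε1 X Y ∘ ε1 (rect X Y) (rect Z W).
Proof. exact: into1. Qed.

Lemma rect_mult2 (X Y Z W : K) :
  ε2 X W ∘ fmap s2 (rect_mult X Y Z W) = ε2 Z W ∘ ε2 (rect X Y) (rect Z W).
Proof. exact: into2. Qed.

Definition rect1E := (rect_map1, rect_unit1, rect_mult1).
Definition rect2E := (rect_map2, rect_unit2, rect_mult2).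

Lemma rect_map_id (X Y : K) : rect_map (idn X) (idn Y) = idn (rect X Y).
Proof. by apply: into_ext; rewrite ?rect1E ?rect2E !fmap1 cmp1f cmpf1. Qed.

Lemma rect_map_cmp (X X' X'' Y Y' Y'' : K) (f : hom X X') (f' : hom X' X'')
    (g : hom Y Y') (g' : hom Y' Y'') :
  rect_map (f' ∘ f) (g' ∘ g) = rect_map f' g' ∘ rect_map f g.
Proof.
by apply: into_ext; rewrite !fmapM cmpA ?rect1E ?rect2E fmapM -!cmpA ?rect1E ?rect2E.
Qed.

Lemma rect_unit_nat (X Y : K) (f : hom X Y) :
  rect_unit Y ∘ f = rect_map f f ∘ rect_unit X.
Proof.
apply: into_ext; rewrite !fmapM !cmpA ?rect1E ?rect2E -!cmpA ?rect1E ?rect2E.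
- by rewrite cmp1f cmpf1.
- by rewrite cmp1f cmpf1.
Qed.

Lemma rect_mult_nat (X X' Y Y' Z Z' W W' : K) (f : hom X X') (g : hom Y Y')
    (h : hom Z Z') (k : hom W W') :
  rect_mult X' Y' Z' W' ∘ rect_map (rect_map f g) (rect_map h k)
  = rect_map f k ∘ rect_mult X Y Z W.
Proof.
apply: into_ext; rewrite !fmapM !cmpA ?rect1E ?rect2E -!cmpA ?rect1E ?rect2E.
- by rewrite !cmpA rect_map1.
- by rewrite !cmpA rect_map2.
Qed.

Lemma rect_assoc (a b c d e f g h : K) :
  rect_mult a b g h ∘ rect_mult (rect a b) (rect c d) (rect e f) (rect g h)
  = rect_mult a d e h ∘ rect_map (rect_mult a b c d) (rect_mult e f g h).
Proof.
apply: into_ext; rewrite !fmapM !cmpA ?rect1E ?rect2E -!cmpA ?rect1E ?rect2E.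
- by rewrite !cmpA rect_mult1.
- by rewrite !cmpA rect_mult2.
Qed.

Lemma rect_unitl (X Y : K) : rect_mult X Y X Y ∘ rect_unit (rect X Y) = idn (rect X Y).
Proof.
by apply: into_ext; rewrite !fmapM !cmpA ?rect1E ?rect2E -!cmpA ?rect1E ?rect2E fmap1.
Qed.

Lemma rect_unitr (X Y : K) :
  rect_mult X X Y Y ∘ rect_map (rect_unit X) (rect_unit Y) = idn (rect X Y).
Proof.
apply: into_ext; rewrite !fmapM !cmpA ?rect1E ?rect2E -!cmpA ?rect1E ?rect2E fmap1.
- by rewrite cmpA rect_unit1 cmp1f cmpf1.
- by rewrite cmpA rect_unit2 cmp1f cmpf1.
Qed.

Definition rectF : Functor (K × K) K :=
  {| fob := fun P : K × K => rect (p1 P) (p2 P);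
     fmap := fun P Q f => rect_map (p1 f) (p2 f);
     fmap1 := fun P => rect_map_id _ _;
     fmapM := fun P Q R g f => rect_map_cmp _ _ _ _ |}.

Lemma rectF_01 : @preserves01 (K × K) K rectF.
Proof.
split=> P.
- move=> /initial_prod [h1 h2]; apply: (spl_initialI (S := S)).
  + by apply: iso_initial (inv_iso (ε1_iso _ _)) _; apply: (proj1 (spl_initial S h1)).
  + by apply: iso_initial (inv_iso (ε2_iso _ _)) _; apply: (proj2 (spl_initial S h2)).
- move=> /terminal_prod [h1 h2]; apply: (spl_terminalI (S := S)).
  + by apply: iso_terminal (inv_iso (ε1_iso _ _)) _; apply: (proj1 (spl_terminal S h1)).
  + by apply: iso_terminal (inv_iso (ε2_iso _ _)) _; apply: (proj2 (spl_terminal S h2)).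
Qed.

Definition rect_act : hom2 (M_monad C) C := @BiQP_hom (M C) C rectF rectF_01.

Definition rect_unitN : NatTrans (idF K) (compF rectF (diagF K)) :=
  {| ntc := rect_unit : forall X, hom (idF K X) (compF rectF (diagF K) X);
     ntP := rect_unit_nat |}.

Definition rect_multN :
  NatTrans (compF rectF (prodF rectF rectF)) (compF rectF (proj14 K)) :=
  {| ntc := (fun P => rect_mult (p1 (p1 P)) (p2 (p1 P)) (p1 (p2 P)) (p2 (p2 P)))
       : forall P, hom (compF rectF (prodF rectF rectF) P) (compF rectF (proj14 K) P);
     ntP := fun P Q f => rect_mult_nat _ _ _ _ |}.

Definition split_alg : PsAlg M_monad.
Proof.
refine {| pa_ob := C; pa_act := rect_act;
  pa_unit := rect_unitN : hom (id1 C) (rect_act ⊙ mon_unit M_monad C);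
  pa_mult := rect_multN : hom (rect_act ⊙ (M_monad @1 rect_act))
                              (rect_act ⊙ mon_mult M_monad C) |}.
- abstract (by apply: nt_is_iso => X; apply: into_iso; apply: iso_idn).
- abstract (by apply: nt_is_iso => P; apply: into_iso; apply: iso_cmp;
    (apply: ε1_iso || apply: ε2_iso)).
- abstract (apply: arr_2cell => // P;
    apply: etrans; [apply: vcomp_ntc; exact: whr_ntc |];
    apply: etrans; [| by symmetry; apply: vcomp_ntc; [exact: whl_ntc | exact: whr_ntc]];
    f_equal; exact: rect_assoc).
- abstract (apply: arr_2cell => // P;
    apply: etrans; [apply: vcomp_ntc; exact: whr_ntc |];
    f_equal; exact: rect_unitl).
- abstract (apply: arr_2cell => // P;
    apply: etrans; [apply: vcomp_ntc; [exact: whl_ntc | exact: whr_ntc] |];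
    f_equal; exact: rect_unitr).
Defined.

Lemma rect_map_iso1 (X X' Y : K) (f : hom X X') :
  is_iso (rect_map f (idn Y)) <-> is_iso (fmap s1 f).
Proof.
split=> h.
- apply: iso_cancel_r (ε1_iso X Y) _; rewrite -(rect_map1 f (idn Y)).
  by apply: iso_cmp (ε1_iso _ _) _; apply: iso_fmap.
- apply: into_iso; last by rewrite fmap1 cmp1f; apply: ε2_iso.
  by apply: iso_cmp h (ε1_iso _ _).
Qed.

Lemma rect_map_iso2 (X Y Y' : K) (f : hom Y Y') :
  is_iso (rect_map (idn X) f) <-> is_iso (fmap s2 f).
Proof.
split=> h.
- apply: iso_cancel_r (ε2_iso X Y) _; rewrite -(rect_map2 (idn X) f).
  by apply: iso_cmp (ε2_iso _ _) _; apply: iso_fmap.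
- apply: into_iso; first by rewrite fmap1 cmp1f; apply: ε1_iso.
  by apply: iso_cmp h (ε2_iso _ _).
Qed.
End AlgOfSplitting.

(** * Rectangular bands of categories *)

(** The part of a pseudo-algebra from which its splitting is built: a categorified
    rectangular band, with laws [X ⊗ X ≅ X] and [(X ⊗ Y) ⊗ (Z ⊗ W) ≅ X ⊗ W] and
    one of the three coherence conditions.  It has a mirror image, [mirror], that
    exchanges the two factors, so that each lemma about the first factor also
    gives one about the second. *)
Record Band (C : Category) := {
  act : C -> C -> C;
  actm : forall X X' Y Y' : C, hom X X' -> hom Y Y' -> hom (act X Y) (act X' Y');
  actm_id : forall X Y, actm (idn X) (idn Y) = idn (act X Y);
  actm_cmp : forall X X' X'' Y Y' Y'' (f : hom X X') (f' : hom X' X'')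
    (g : hom Y Y') (g' : hom Y' Y''), actm (f' ∘ f) (g' ∘ g) = actm f' g' ∘ actm f g;
  bu : forall X, hom X (act X X);
  bu_nat : forall X Y (f : hom X Y), bu Y ∘ f = actm f f ∘ bu X;
  bu_iso : forall X, is_iso (bu X);
  bm : forall X Y Z W, hom (act (act X Y) (act Z W)) (act X W);
  bm_nat : forall X X' Y Y' Z Z' W W' (f : hom X X') (g : hom Y Y') (h : hom Z Z')
    (k : hom W W'),
    bm X' Y' Z' W' ∘ actm (actm f g) (actm h k) = actm f k ∘ bm X Y Z W;
  bm_iso : forall X Y Z W, is_iso (bm X Y Z W);
  bm_bu : forall X Y, bm X X Y Y ∘ actm (bu X) (bu Y) = idn (act X Y) }.

Definition mirror (C : Category) (B : Band C) : Band C :=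
  {| act := fun X Y => act B Y X;
     actm := fun _ _ _ _ f g => actm B g f;
     actm_id := fun _ _ => actm_id B _ _;
     actm_cmp := fun _ _ _ _ _ _ _ _ _ _ => actm_cmp B _ _ _ _;
     bu := bu B; bu_nat := bu_nat B; bu_iso := bu_iso B;
     bm := fun X Y Z W => bm B W Z Y X;
     bm_nat := fun _ _ _ _ _ _ _ _ _ _ _ _ => bm_nat B _ _ _ _;
     bm_iso := fun _ _ _ _ => bm_iso B _ _ _ _;
     bm_bu := fun _ _ => bm_bu B _ _ |}.

Section Band.
Variables (C : Category) (B : Band C).
Local Notation "X ⊗ Y" := (act B X Y) (at level 35, right associativity).
Local Notation "f ⊠ g" := (actm B f g) (at level 35, right associativity).

(** The morphisms [f ⊠ idn Z] stand for the component of [f] in a first factor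
    that is not yet constructed; no [Z] is preferred, and by [eq1_of_actm] and
    [w1_of_actm] any one of them is as good as all. *)
Definition eq1 (X Y : C) (f g : hom X Y) : Prop :=
  forall Z, f ⊠ idn Z = g ⊠ idn Z.

Definition w1 (X Y : C) (f : hom X Y) : Prop := forall Z, is_iso (f ⊠ idn Z).

Lemma actm_iso (X X' Y Y' : C) (f : hom X X') (g : hom Y Y') :
  is_iso f -> is_iso g -> is_iso (f ⊠ g).
Proof.
move=> [f' [f1 f2]] [g' [g1 g2]]; exists (f' ⊠ g').
by rewrite -!actm_cmp f1 f2 g1 g2 !actm_id.
Qed.

(** By the law [(X ⊗ Y) ⊗ (Z ⊗ Z) ≅ X ⊗ Z], the morphism [f ⊠ h] determines
    [f ⊠ idn Z] for all [Z]; the same isomorphisms carry invertibility over in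
    the next two lemmas. *)
Lemma eq1_of_actm (X X' Y Y' : C) (f g : hom X X') (h k : hom Y Y') :
  f ⊠ h = g ⊠ k -> eq1 f g.
Proof.
move=> e Z; apply: (iso_epi (bm_iso B X Y Z Z)).
by rewrite -(bm_nat B f h (idn Z)) -(bm_nat B g k (idn Z)) e.
Qed.

Lemma w1_of_actm (X X' Y Y' : C) (f : hom X X') (h : hom Y Y') :
  is_iso (f ⊠ h) -> w1 f.
Proof.
move=> i Z; apply: (iso_cancel_r (bm_iso B X Y Z Z)).
rewrite -(bm_nat B f h (idn Z)); apply: iso_cmp (bm_iso _ _ _ _ _) _.
by apply: actm_iso => //; rewrite actm_id; apply: iso_idn.
Qed.

Lemma actm_w1 (X X' Y Y' : C) (f : hom X X') (h : hom Y Y') : w1 f -> w1 (f ⊠ h).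
Proof.
move=> i; apply: (@w1_of_actm _ _ (X ⊗ X) _ _ (idn X ⊠ idn X)).
apply: (iso_cancel_l (bm_iso B _ _ _ _)); rewrite bm_nat.
by apply: iso_cmp (i X) (bm_iso _ _ _ _ _).
Qed.

Lemma w1_iso (X Y : C) (f : hom X Y) : is_iso f -> w1 f.
Proof. by move=> i Z; apply: actm_iso i (iso_idn _). Qed.

Lemma actm_cmp1 (X Y Z V : C) (g : hom Y Z) (f : hom X Y) :
  (g ∘ f) ⊠ idn V = (g ⊠ idn V) ∘ (f ⊠ idn V).
Proof. by rewrite -actm_cmp cmp1f. Qed.

Lemma w1_cmp (X Y Z : C) (g : hom Y Z) (f : hom X Y) : w1 g -> w1 f -> w1 (g ∘ f).
Proof. by move=> hg hf V; rewrite actm_cmp1; apply: iso_cmp. Qed.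

Lemma eq1_cmp (X Y Z : C) (g g' : hom Y Z) (f f' : hom X Y) :
  eq1 g g' -> eq1 f f' -> eq1 (g ∘ f) (g' ∘ f').
Proof. by move=> hg hf V; rewrite !actm_cmp1 hg hf. Qed.

Lemma eq1_refl (X Y : C) (f : hom X Y) : eq1 f f.
Proof. by []. Qed.

Lemma eq1_cancel_l (X Y Z : C) (q : hom Y Z) (f g : hom X Y) :
  w1 q -> eq1 (q ∘ f) (q ∘ g) -> eq1 f g.
Proof. by move=> i e V; apply: (iso_mono (i V)); rewrite -!actm_cmp1. Qed.

Lemma eq1_cancel_r (X Y Z : C) (q : hom X Y) (f g : hom Y Z) :
  w1 q -> eq1 (f ∘ q) (g ∘ q) -> eq1 f g.
Proof. by move=> i e V; apply: (iso_epi (i V)); rewrite -!actm_cmp1. Qed.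

(** Agreement in the first factor spreads along a span
    [P1 <- P0 -> P2] on which [a] and [b] are natural. *)
Lemma eq1_spread (P0 P1 P2 Q0 Q1 Q2 : C) (p : hom P0 P1) (p' : hom P0 P2)
    (q : hom Q0 Q1) (q' : hom Q0 Q2) (a0 b0 : hom P0 Q0) (a1 b1 : hom P1 Q1)
    (a2 b2 : hom P2 Q2) :
  q ∘ a0 = a1 ∘ p -> q ∘ b0 = b1 ∘ p -> q' ∘ a0 = a2 ∘ p' -> q' ∘ b0 = b2 ∘ p' ->
  w1 q -> w1 p' -> a1 = b1 -> eq1 a2 b2.
Proof.
move=> ea eb ea' eb' hq hp' e; apply: (eq1_cancel_r hp').
rewrite -ea' -eb'; apply: eq1_cmp (eq1_refl _) _.
by apply: (eq1_cancel_l hq); rewrite ea eb e.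
Qed.

Lemma eq1_of_initial (X Y Z : C) (f g : hom X Y) : initial (X ⊗ Z) -> eq1 f g.
Proof. by move=> h; apply: (@eq1_of_actm _ _ Z Z _ _ (idn Z) (idn Z)); apply: initial_uniq. Qed.

Lemma eq1_of_terminal (X Y Z : C) (f g : hom X Y) : terminal (Y ⊗ Z) -> eq1 f g.
Proof. by move=> h; apply: (@eq1_of_actm _ _ Z Z _ _ (idn Z) (idn Z)); apply: terminal_uniq. Qed.

End Band.

Notation eq2 B := (eq1 (mirror B)).
Notation w2 B := (w1 (mirror B)).

Section Band2.
Variables (C : Category) (B : Band C).
Local Notation "X ⊗ Y" := (act B X Y) (at level 35, right associativity).
Local Notation "f ⊠ g" := (actm B f g) (at level 35, right associativity).

Lemma actm_split (X X' Y Y' : C) (f : hom X X') (g : hom Y Y') :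
  f ⊠ g = (f ⊠ idn Y') ∘ (idn X ⊠ g).
Proof. by rewrite -actm_cmp cmp1f cmpf1. Qed.

Lemma actm_ext (X X' Y Y' : C) (f f' : hom X X') (g g' : hom Y Y') :
  eq1 B f f' -> eq2 B g g' -> f ⊠ g = f' ⊠ g'.
Proof.
move=> e1 e2; rewrite actm_split e1 [RHS]actm_split; congr cmp; exact: e2.
Qed.

(** Up to [X ⊗ X ≅ X], a morphism [f] is [f ⊠ f], which [actm_ext] splits into
    its two components. *)
Lemma eq12 (X Y : C) (f g : hom X Y) : eq1 B f g -> eq2 B f g -> f = g.
Proof.
move=> e1 e2; apply: (iso_mono (bu_iso B Y)).
by rewrite !bu_nat (actm_ext e1 e2).
Qed.

Lemma actm_iso12 (X X' Y Y' : C) (f : hom X X') (g : hom Y Y') :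
  w1 B f -> w2 B g -> is_iso (f ⊠ g).
Proof. by move=> h1 h2; rewrite actm_split; apply: iso_cmp (h1 _) (h2 _). Qed.

End Band2.

(** * The splitting of a band *)

Section FullImage.
Variables (C D : Category) (F : Functor C D).

Definition FullImage : Category :=
  {| obj := C; hom := fun X Y => hom (F X) (F Y); idn := fun X => idn (F X);
     cmp := fun _ _ _ g f => g ∘ f;
     cmpA := fun _ _ _ _ h g f => cmpA h g f;
     cmp1f := fun _ _ f => cmp1f f; cmpf1 := fun _ _ f => cmpf1 f |}.

Definition toFullImage : Functor C FullImage :=
  {| fob := fun X : C => (X : FullImage);
     fmap := fun (X Y : C) (f : hom X Y) => fmap F f : @hom FullImage X Y;
     fmap1 := fmap1 F; fmapM := fmapM F |}.
End FullImage.

Section Factor.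
Variables (C : Category) (B : Band C).
Local Notation "X ⊗ Y" := (act B X Y) (at level 35, right associativity).
Local Notation "f ⊠ g" := (actm B f g) (at level 35, right associativity).
Hypothesis bq : biqpointed C.
Variables (O : C).
Hypothesis iO : initial O.

Definition actF : Functor C C :=
  {| fob := fun X => X ⊗ O; fmap := fun _ _ f => f ⊠ idn O;
     fmap1 := fun _ => actm_id B _ _; fmapM := fun _ _ _ _ _ => actm_cmp1 B O _ _ |}.

(** The first factor [A] of [C].  Up to equivalence its objects are the [X ⊗ O],
    but with the objects of [C] the projection from [C] is the identity on
    objects. *)
Definition factor : Category := FullImage actF.

Lemma square_initial : initial (O ⊗ O).
Proof. exact: iso_initial (bu_iso B O) iO. Qed.

(** In the second factor [X ⊗ O] is the initial object. *)
Lemma eq2_from_factor (X Y : C) (f g : hom (X ⊗ O) Y) : eq2 B f g.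
Proof.
apply: (@eq1_of_initial _ _ _ _ (O ⊗ O)).
by apply: iso_initial (inv_iso (bm_iso B O O X O)) square_initial.
Qed.

(** Between objects [X ⊗ O] only the first factor matters, and there [T ⊗ O]
    may be replaced by [T ⊗ T], which is terminal in [C]. *)
Lemma factor_biqpointed : biqpointed factor.
Proof.
have [T hT] := biqpointed_terminal bq.
have tTT : terminal (T ⊗ T) by exact: iso_terminal (bu_iso B T) hT.
have tT : terminal ((T ⊗ O) ⊗ (T ⊗ T)).
  by apply: iso_terminal (inv_iso (bm_iso B T O T T)) tTT.
exists O, T; split; last split.
- by move=> Y; apply: square_initial.
- apply: terminalP => X.
  + by have [f _] := @terminal_hom C T X hT; exists (f ⊠ idn O).
  + by move=> f g; apply: eq12 (eq2_from_factor _ _); apply: eq1_of_terminal tT.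
- move=> f; split=> Z u v e.
  + exact: (initial_mono bq square_initial) e.
  + apply: eq12 (eq2_from_factor _ _).
    apply: (@eq1_of_actm _ B _ _ (T ⊗ T) (T ⊗ T) _ _ (idn _) (idn _)).
    apply: (terminal_epi (f := f ⊠ idn (T ⊗ T)) bq tT).
    by rewrite -!actm_cmp1; congr actm.
Qed.

Definition bang (X : C) : hom O X :=
  proj1_sig (constructive_indefinite_description _ (initial_hom X iO)).

Lemma bang_uniq (X : C) (f g : hom O X) : f = g.
Proof. exact: initial_uniq. Qed.

(** In [A × B] this is the arrow from [(a, 0)] to [(a, b)]. *)
Definition ι (X : C) : hom (X ⊗ O) X := inv (bu_iso B X) ∘ (idn X ⊠ bang X).

Lemma bu_ι (X : C) : bu B X ∘ ι X = idn X ⊠ bang X.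
Proof. by rewrite cmpA invKV cmp1f. Qed.

Lemma ι_nat (X Y : C) (f : hom X Y) : f ∘ ι X = ι Y ∘ (f ⊠ idn O).
Proof.
apply: (iso_mono (bu_iso B Y)); rewrite (cmpA (bu B Y) f) bu_nat -(cmpA (f ⊠ f)) (cmpA _ (ι Y)) !bu_ι -!actm_cmp.
by rewrite cmp1f cmpf1; congr actm; apply: bang_uniq.
Qed.

Lemma idm_w1 (X Y Z : C) (g : hom Y Z) : w1 B (idn X ⊠ g).
Proof. by apply: actm_w1; apply: w1_iso; apply: iso_idn. Qed.

Lemma ι_w1 (X : C) : w1 B (ι X).
Proof. by apply: w1_cmp (idm_w1 _ _); apply: w1_iso; apply: inv_iso. Qed.

(** Naturality of [ι], which is invertible in the first factor, makes
    [f ⊠ idn O] agree with [a] there. *)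
Lemma factor_component (X Y : C) (a : hom (X ⊗ O) (Y ⊗ O)) (f : hom X Y) :
  eq1 B (f ∘ ι X) (ι Y ∘ a) -> f ⊠ idn O = a.
Proof.
move=> e; apply: eq12 (eq2_from_factor _ _); apply: (eq1_cancel_l (ι_w1 Y)).
by rewrite -ι_nat.
Qed.
End Factor.

Section BandSplitting.
Variables (C : Category) (B : Band C).
Local Notation "X ⊗ Y" := (act B X Y) (at level 35, right associativity).
Local Notation "f ⊠ g" := (actm B f g) (at level 35, right associativity).
Hypothesis bq : biqpointed C.
Variables (O : C).
Hypothesis iO : initial O.
Local Notation i := (ι B iO).
Local Notation k := (ι (mirror B) iO).

(** An object is recovered from its two components:
    [(X ⊗ 0) ⊗ (0 ⊗ X) ≅ X ⊗ X ≅ X]. *)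
Lemma ικ_iso (X : C) : is_iso (i X ⊠ k X).
Proof. by apply: actm_iso12; apply: ι_w1. Qed.

(** The required [f] is [a ⊠ b], transported along the isomorphisms of
    [ικ_iso].  Its components agree with [a] and [b] after composing with [ι]. *)
Lemma band_full (X Y : C) (a : hom (X ⊗ O) (Y ⊗ O)) (b : hom (O ⊗ X) (O ⊗ Y)) :
  exists f : hom X Y, f ⊠ idn O = a /\ idn O ⊠ f = b.
Proof.
pose f := inv (bu_iso B Y) ∘ ((i Y ∘ a) ⊠ (k Y ∘ b)) ∘ inv (ικ_iso X) ∘ bu B X.
have e : (f ∘ i X) ⊠ (f ∘ k X) = (i Y ∘ a) ⊠ (k Y ∘ b).
  have ef : f ⊠ f = ((i Y ∘ a) ⊠ (k Y ∘ b)) ∘ inv (ικ_iso X).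
    by apply: (iso_epi (bu_iso B X)); rewrite -bu_nat /f !cmpA invKV cmp1f.
  by rewrite actm_cmp ef -cmpA invK cmpf1.
exists f; split.
- by apply: (factor_component (iO := iO)); apply: eq1_of_actm e.
- apply: (factor_component (B := mirror B) (iO := iO)).
  exact: (eq1_of_actm (B := mirror B) e).
Qed.

Lemma band_eso (a b : C) : is_iso (bm B a b O O ∘ (idn (a ⊗ b) ⊠ bu B O)).
Proof.
by apply: iso_cmp (bm_iso _ _ _ _ _) _; apply: actm_iso (iso_idn _) (bu_iso _ _).
Qed.

Definition band_splitting : Splitting C.
Proof.
refine {| spl1 := toFullImage (actF B O); spl2 := toFullImage (actF (mirror B) O);
  splA_bq := factor_biqpointed B bq iO;
  splB_bq := factor_biqpointed (mirror B) bq iO;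
  spl_full := band_full |}.
- abstract (by move=> X Y f g e1 e2; apply: (eq12 (B := B));
    [apply: (eq1_of_actm e1) | apply: (eq1_of_actm (B := mirror B) e2)]).
- abstract (by move=> a b; exists (a ⊗ b), (bm B a b O O ∘ (idn (a ⊗ b) ⊠ bu B O)),
    (bm B O O a b ∘ (bu B O ⊠ idn (a ⊗ b))); split;
    [apply: band_eso
    | apply: iso_cmp (bm_iso _ _ _ _ _) _; apply: actm_iso (bu_iso _ _) (iso_idn _)]).
Defined.

Lemma band_splitting1 (X Y : C) (f : hom X Y) :
  is_iso (fmap (spl1 band_splitting) f) <-> w1 B f.
Proof. by split=> [h|h]; [apply: w1_of_actm h | apply: h]. Qed.

Lemma band_splitting2 (X Y : C) (f : hom X Y) :
  is_iso (fmap (spl2 band_splitting) f) <-> w2 B f.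
Proof. by split=> [h|h]; [apply: (w1_of_actm (B := mirror B) h) | apply: h]. Qed.
End BandSplitting.

(** * Morphisms of bands *)

Record BandMap (C D : Category) (B : Band C) (B' : Band D) (G : Functor C D) := {
  bs : forall X Y : C, hom (act B' (G X) (G Y)) (G (act B X Y));
  bs_nat : forall X X' Y Y' (f : hom X X') (g : hom Y Y'),
    bs X' Y' ∘ actm B' (fmap G f) (fmap G g) = fmap G (actm B f g) ∘ bs X Y;
  bs_iso : forall X Y, is_iso (bs X Y);
  bs_bu : forall X, bs X X ∘ bu B' (G X) = fmap G (bu B X) }.

Definition mirror_map (C D : Category) (B : Band C) (B' : Band D) (G : Functor C D)
    (s : BandMap B B' G) : BandMap (mirror B) (mirror B') G :=
  {| bs := fun X Y => bs s Y X : hom (act (mirror B') (G X) (G Y)) (G (act (mirror B) X Y));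
     bs_nat := fun _ _ _ _ _ _ => bs_nat s _ _;
     bs_iso := fun _ _ => bs_iso s _ _;
     bs_bu := bs_bu s |}.

Section BandMaps.
Variables (C D : Category) (B : Band C) (B' : Band D).
Local Notation "X ⊗ Y" := (act _ X Y) (at level 35, right associativity).
Local Notation "f ⊠ g" := (actm _ f g) (at level 35, right associativity).

Lemma bandmap_w1 (G : Functor C D) (s : BandMap B B' G) (X Y : C) (f : hom X Y) :
  w1 B f -> w1 B' (fmap G f).
Proof.
move=> h; apply: (@w1_of_actm _ B' _ _ (G X) (G X) _ (fmap G (idn X))).
apply: (iso_cancel_l (bs_iso s Y X)); rewrite bs_nat.
by apply: iso_cmp (bs_iso _ _ _); apply: iso_fmap.
Qed.

Variables (O : C).
Hypothesis iO : initial O.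
Local Notation "! X" := (bang iO X) (at level 30).

(** Both sides are natural in [X] and [Y].  They agree on the diagonal by
    compatibility with [bu], and agreement in the first factor spreads from
    [(X, X)] to [(X, Y)] along [(X, X) <- (X, 0) -> (X, Y)]. *)
Lemma two_cell_eq1 (G H : Functor C D) (s : BandMap B B' G) (s' : BandMap B B' H)
    (t : NatTrans G H) (X Y : C) :
  eq1 B' (t (X ⊗ Y) ∘ bs s X Y) (bs s' X Y ∘ (t X ⊠ t Y)).
Proof.
have nat1 : forall X X' Y Y' (f : hom X X') (g : hom Y Y'),
    fmap H (f ⊠ g) ∘ (t (X ⊗ Y) ∘ bs s X Y)
    = t (X' ⊗ Y') ∘ bs s X' Y' ∘ (fmap G f ⊠ fmap G g).
  by move=> *; rewrite -cmpA bs_nat !cmpA ntP.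
have nat2 : forall X X' Y Y' (f : hom X X') (g : hom Y Y'),
    fmap H (f ⊠ g) ∘ (bs s' X Y ∘ (t X ⊠ t Y))
    = bs s' X' Y' ∘ (t X' ⊠ t Y') ∘ (fmap G f ⊠ fmap G g).
  by move=> *; rewrite -cmpA -actm_cmp !ntP actm_cmp !cmpA bs_nat.
apply: (eq1_spread (nat1 _ _ _ _ (idn X) (! X)) (nat2 _ _ _ _ (idn X) (! X))
          (nat1 _ _ _ _ (idn X) (! Y)) (nat2 _ _ _ _ (idn X) (! Y))).
- by apply: (bandmap_w1 s'); apply: idm_w1.
- by rewrite fmap1; apply: idm_w1.
- apply: (iso_epi (bu_iso B' (G X))).
  by rewrite -cmpA bs_bu ntP -cmpA -bu_nat cmpA bs_bu.
Qed.

(** The same argument with four variables, along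
    [(X, X, X, X) <- (X, 0, 0, 0) -> (X, Y, Z, W)]; on the diagonal, [bm_bu]
    reduces both sides to [bs s X X]. *)
Lemma mult_eq1 (G : Functor C D) (s : BandMap B B' G) (X Y Z W : C) :
  eq1 B' (bs s X W ∘ bm B' (G X) (G Y) (G Z) (G W))
         (fmap G (bm B X Y Z W) ∘ (bs s (X ⊗ Y) (Z ⊗ W) ∘ (bs s X Y ⊠ bs s Z W))).
Proof.
have nat1 : forall X X' Y Y' Z Z' W W' (f : hom X X') (g : hom Y Y')
      (h : hom Z Z') (k : hom W W'),
    fmap G (f ⊠ k) ∘ (bs s X W ∘ bm B' (G X) (G Y) (G Z) (G W))
    = bs s X' W' ∘ bm B' (G X') (G Y') (G Z') (G W')
      ∘ ((fmap G f ⊠ fmap G g) ⊠ (fmap G h ⊠ fmap G k)).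
  by move=> *; rewrite cmpA -bs_nat -!cmpA bm_nat.
have nat2 : forall X X' Y Y' Z Z' W W' (f : hom X X') (g : hom Y Y')
      (h : hom Z Z') (k : hom W W'),
    fmap G (f ⊠ k) ∘
      (fmap G (bm B X Y Z W) ∘ (bs s (X ⊗ Y) (Z ⊗ W) ∘ (bs s X Y ⊠ bs s Z W)))
    = fmap G (bm B X' Y' Z' W')
      ∘ (bs s (X' ⊗ Y') (Z' ⊗ W') ∘ (bs s X' Y' ⊠ bs s Z' W'))
      ∘ ((fmap G f ⊠ fmap G g) ⊠ (fmap G h ⊠ fmap G k)).
  move=> X0 X1 Y0 Y1 Z0 Z1 W0 W1 f g h k.
  rewrite cmpA -fmapM -(bm_nat B f g h k) fmapM -!cmpA; congr cmp.
  by rewrite -actm_cmp !bs_nat actm_cmp !cmpA bs_nat.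
apply: (eq1_spread (nat1 _ _ _ _ _ _ _ _ (idn X) (! X) (! X) (! X))
          (nat2 _ _ _ _ _ _ _ _ (idn X) (! X) (! X) (! X))
          (nat1 _ _ _ _ _ _ _ _ (idn X) (! Y) (! Z) (! W))
          (nat2 _ _ _ _ _ _ _ _ (idn X) (! Y) (! Z) (! W))).
- by apply: (bandmap_w1 s); apply: idm_w1.
- by rewrite fmap1; apply: actm_w1; apply: idm_w1.
- apply: (iso_epi (actm_iso B' (bu_iso B' (G X)) (bu_iso B' (G X)))).
  rewrite -!cmpA bm_bu cmpf1 -actm_cmp bs_bu bs_nat cmpA -fmapM bm_bu.
  by rewrite fmap1 cmp1f.
Qed.

End BandMaps.

Section BandMapTheory.
Variables (C D : Category) (B : Band C) (B' : Band D) (O : C).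
Hypothesis iO : initial O.
Local Notation "X ⊗ Y" := (act _ X Y) (at level 35, right associativity).
Local Notation "f ⊠ g" := (actm _ f g) (at level 35, right associativity).
Local Notation "! X" := (bang iO X) (at level 30).

Lemma bandmap_2cell (G H : Functor C D) (s : BandMap B B' G) (s' : BandMap B B' H)
    (t : NatTrans G H) (X Y : C) :
  t (X ⊗ Y) ∘ bs s X Y = bs s' X Y ∘ (t X ⊠ t Y).
Proof.
apply: eq12; first exact: (two_cell_eq1 iO).
exact: (two_cell_eq1 iO (mirror_map s) (mirror_map s') t Y X).
Qed.

Lemma bandmap_mult (G : Functor C D) (s : BandMap B B' G) (X Y Z W : C) :
  bs s X W ∘ bm B' (G X) (G Y) (G Z) (G W)
  = fmap G (bm B X Y Z W) ∘ (bs s (X ⊗ Y) (Z ⊗ W) ∘ (bs s X Y ⊠ bs s Z W)).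
Proof.
apply: eq12; first exact: (mult_eq1 iO).
exact: (mult_eq1 iO (mirror_map s) W Z Y X).
Qed.

(** Case [t = idNT G] of [bandmap_2cell]: being a morphism of bands is a property
    of the functor. *)
Lemma bandmap_uniq (G : Functor C D) (s s' : BandMap B B' G) (X Y : C) :
  bs s X Y = bs s' X Y.
Proof.
by have := bandmap_2cell s s' (idNT G) X Y; rewrite /= actm_id cmp1f cmpf1.
Qed.

Section Exists.
Variable G : Functor C D.
Hypothesis G1 : forall (X Y : C) (f : hom X Y), w1 B f -> w1 B' (fmap G f).
Hypothesis G2 : forall (X Y : C) (f : hom X Y), w2 B f -> w2 B' (fmap G f).
Local Notation i := (ι B iO).
Local Notation k := (ι (mirror B) iO).

(** [G X ⊗ G Y] and [G (X ⊗ Y)] are connected by isomorphisms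
    [G X ⊗ G Y <- G (X ⊗ 0) ⊗ G (0 ⊗ Y) -> G (X ⊗ Y) ⊗ G (X ⊗ Y) <- G (X ⊗ Y)];
    the first two are invertible because all first components are in [w1] and
    all second components in [w2]. *)
Definition to_images (X Y : C) : hom (G (X ⊗ O) ⊗ G (O ⊗ Y)) (act B' (G X) (G Y)) :=
  fmap G (i X) ⊠ fmap G (k Y).

Definition to_square (X Y : C) :
  hom (G (X ⊗ O) ⊗ G (O ⊗ Y)) (act B' (G (act B X Y)) (G (act B X Y))) :=
  fmap G (idn X ⊠ ! Y) ⊠ fmap G (! X ⊠ idn Y).

Lemma to_images_iso (X Y : C) : is_iso (to_images X Y).
Proof. by apply: actm_iso12; [apply: G1 | apply: G2]; apply: ι_w1. Qed.

Lemma to_square_iso (X Y : C) : is_iso (to_square X Y).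
Proof.
apply: actm_iso12; [apply: G1 | apply: G2]; first exact: idm_w1.
exact: (idm_w1 (mirror B)).
Qed.

Definition comparison (X Y : C) : hom (act B' (G X) (G Y)) (G (act B X Y)) :=
  inv (bu_iso B' _) ∘ (to_square X Y ∘ inv (to_images_iso X Y)).

Lemma comparison_iso (X Y : C) : is_iso (comparison X Y).
Proof.
apply: iso_cmp (inv_iso _) _.
by apply: iso_cmp (to_square_iso _ _) (inv_iso _).
Qed.

Lemma to_images_nat (X X' Y Y' : C) (f : hom X X') (g : hom Y Y') :
  (fmap G f ⊠ fmap G g) ∘ to_images X Y
  = to_images X' Y' ∘ (fmap G (f ⊠ idn O) ⊠ fmap G (idn O ⊠ g)).
Proof.
rewrite -!actm_cmp -!fmapM ι_nat; congr (_ ⊠ fmap G _).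
exact: (ι_nat (mirror B)).
Qed.

Lemma to_square_nat (X X' Y Y' : C) (f : hom X X') (g : hom Y Y') :
  (fmap G (f ⊠ g) ⊠ fmap G (f ⊠ g)) ∘ to_square X Y
  = to_square X' Y' ∘ (fmap G (f ⊠ idn O) ⊠ fmap G (idn O ⊠ g)).
Proof.
rewrite -!actm_cmp -!fmapM -!actm_cmp !cmp1f !cmpf1.
by congr (fmap G (_ ⊠ _) ⊠ fmap G (_ ⊠ _)); apply: bang_uniq.
Qed.

Lemma comparison_nat (X X' Y Y' : C) (f : hom X X') (g : hom Y Y') :
  comparison X' Y' ∘ (fmap G f ⊠ fmap G g) = fmap G (f ⊠ g) ∘ comparison X Y.
Proof.
rewrite /comparison -!cmpA (inv_square (to_images_iso _ _) _ (to_images_nat f g)).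
rewrite (cmpA (to_square X' Y')) -to_square_nat -!cmpA.
rewrite cmpA (inv_square (bu_iso _ _) (bu_iso _ _) (p := fmap G (f ⊠ g))) ?cmpA //.
by rewrite bu_nat.
Qed.

Lemma comparison_bu (X : C) : comparison X X ∘ bu B' (G X) = fmap G (bu B X).
Proof.
have e : to_square X X = (fmap G (bu B X) ⊠ fmap G (bu B X)) ∘ to_images X X.
  rewrite -actm_cmp -!fmapM bu_ι; congr (_ ⊠ fmap G _).
  exact: esym (bu_ι (mirror B) iO X).
rewrite /comparison e -!cmpA (cmpA (to_images X X)) invKV cmp1f -bu_nat.
by rewrite cmpA invK cmp1f.
Qed.

Definition bandmap_of_preserves : BandMap B B' G :=
  {| bs := comparison; bs_nat := comparison_nat; bs_iso := comparison_iso;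
     bs_bu := comparison_bu |}.
End Exists.
End BandMapTheory.

(** * Pseudo-algebras and pseudo-morphisms in terms of bands *)

Lemma arr_ntc (C D : BiQPointCat) (F G F' G' : hom2 C D) (s : hom F G) (t : hom F' G')
    (X : bq_cat C) : arr s = arr t -> arr (ntc s X) = arr (ntc t X).
Proof. exact: (f_equal (fun a : Arr (hom2 C D) => arr (ntc (aarr a) X))). Qed.

Section AlgBand.
Variable A : PsAlg M_monad.
Local Notation K := (bq_cat (pa_ob A)).
Local Notation α := (sub_ob (pa_act A)).

Definition alg_act (X Y : K) : K := α ⟨X, Y⟩.

Definition alg_actm (X X' Y Y' : K) (f : hom X X') (g : hom Y Y') :
  hom (alg_act X Y) (alg_act X' Y') :=
  fmap α (⟨f, g⟩ : hom (⟨X, Y⟩ : bq_cat (M_monad (pa_ob A))) ⟨X', Y'⟩).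

Definition alg_band : Band K.
Proof.
refine {| act := alg_act; actm := alg_actm; bu := ntc (pa_unit A);
  bm := fun X Y Z W => ntc (pa_mult A) ⟨⟨X, Y⟩, ⟨Z, W⟩⟩ |}.
- abstract (by move=> X Y; apply: (fmap1 α)).
- abstract (by move=> *; rewrite /alg_actm -(fmapM α)).
- abstract (by move=> X Y f; apply: (ntP (pa_unit A))).
- abstract (by move=> X; apply: ntc_is_iso (pa_unit_iso A)).
- abstract (by move=> X X' Y Y' Z Z' W W' f g h k;
    apply: (@ntP _ _ _ _ (pa_mult A) ⟨⟨X, Y⟩, ⟨Z, W⟩⟩ ⟨⟨X', Y'⟩, ⟨Z', W'⟩⟩
      ⟨⟨f, g⟩, ⟨h, k⟩⟩)).
- abstract (by move=> X Y Z W; exact: (@ntc_is_iso _ _ _ _ (pa_mult A) ⟨⟨X, Y⟩, ⟨Z, W⟩⟩ (pa_mult_iso A))).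
- abstract (move=> X Y; apply: arr_inj;
    apply: etrans _ (arr_ntc (⟨X, Y⟩ : bq_cat (M_monad (pa_ob A))) (pa_unitr A));
    symmetry;
    apply: vcomp_ntc; [exact: whl_ntc | exact: whr_ntc]).
Defined.

Lemma alg_biqpointed : biqpointed K.
Proof. exact: bq_prop. Qed.

End AlgBand.

Section PsMorBand.
Variables A B : PsAlg M_monad.

Definition psmor_bandmap (f : PsMor A B) :
  BandMap (alg_band A) (alg_band B) (sub_ob (pm_cell f)).
Proof.
refine {| bs := fun X Y => ntc (pm_str f) ⟨X, Y⟩ :
  hom (act (alg_band B) (sub_ob (pm_cell f) X) (sub_ob (pm_cell f) Y))
      (sub_ob (pm_cell f) (act (alg_band A) X Y)) |}.
- abstract (by move=> X X' Y Y' g h;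
    apply: (@ntP _ _ _ _ (pm_str f) ⟨X, Y⟩ ⟨X', Y'⟩ ⟨g, h⟩)).
- abstract (by move=> X Y; exact: (@ntc_is_iso _ _ _ _ (pm_str f) ⟨X, Y⟩ (pm_str_iso f))).
- abstract (move=> X; apply: arr_inj; apply: etrans _ (whl_ntc (pm_cell f) (pa_unit A) X);
    apply: etrans _ (arr_ntc X (pm_unit f)); symmetry;
    apply: vcomp_ntc; exact: whr_ntc).
Defined.

Section OfBandMap.
Variables (G : hom2 (pa_ob A) (pa_ob B))
  (s : BandMap (alg_band A) (alg_band B) (sub_ob G)).

Definition bandmap_str : hom (pa_act B ⊙ (M_monad @1 G)) (G ⊙ pa_act A).
Proof.
refine (@Build_NatTrans _ _ (sub_ob (pa_act B ⊙ (M_monad @1 G))) (sub_ob (G ⊙ pa_act A))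
  (fun P => bs s (p1 P) (p2 P)) _).
abstract (by move=> P Q f; exact: (bs_nat s (p1 f) (p2 f))).
Defined.

Definition psmor_of_bandmap : PsMor A B.
Proof.
refine {| pm_cell := G; pm_str := bandmap_str |}.
- abstract (by apply: nt_is_iso => P; exact: (bs_iso s (p1 P) (p2 P))).
- abstract (apply: arr_2cell => // X;
    apply: etrans; [apply: vcomp_ntc; exact: whr_ntc |];
    apply: etrans _ (esym (whl_ntc G (pa_unit A) X)); f_equal; exact: (bs_bu s)).
- abstract (have [O [_ [iO _]]] := alg_biqpointed A;
    apply: arr_2cell => // P;
    apply: etrans; [apply: vcomp_ntc; exact: whr_ntc |];
    symmetry; apply: etrans;
      [apply: vcomp_ntc;
        [apply: vcomp_ntc; [exact: whl_ntc | exact: whr_ntc] | exact: whl_ntc] |];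
    f_equal; symmetry; exact: (bandmap_mult iO s)).
Defined.
End OfBandMap.

Lemma psmor_uniq (f g : PsMor A B) : pm_cell f = pm_cell g -> f = g.
Proof.
have [O [_ [iO _]]] := alg_biqpointed A.
move=> e; apply: pm_eq => //.
case: f g e => F sf sf_iso sf_unit sf_mult [G sg sg_iso sg_unit sg_mult] /= e.
subst G; congr arr; apply: nt_eq => P.
exact: (bandmap_uniq iO (psmor_bandmap (Build_PsMor sf_iso sf_unit sf_mult))
          (psmor_bandmap (Build_PsMor sg_iso sg_unit sg_mult)) (p1 P) (p2 P)).
Qed.

Lemma psmor_2cell (f g : PsMor A B) (t : hom (pm_cell f) (pm_cell g)) : pm_2cell t.
Proof.
have [O [_ [iO _]]] := alg_biqpointed A.
apply: nt_eq => P.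
have e := bandmap_2cell iO (psmor_bandmap f) (psmor_bandmap g) t (p1 P) (p2 P).
rewrite /= fmap1 cmpf1 cmp1f; exact: e.
Qed.

End PsMorBand.

(** * Pretorsion theories and splittings *)

(** The torsion and torsion-free objects are those of
    [(A, A, 1) × (B, 0, B)]. *)
Definition splits (P : Triple) (S : Splitting P) : Prop :=
  (forall X : P, tors X <-> initial (spl2 S X)) /\
  (forall X : P, tfree X <-> terminal (spl1 S X)).

Section ShortExact.
Variables (P : Triple) (S : Splitting P).
Hypothesis h : splits S.
Local Notation s1 := (spl1 S).
Local Notation s2 := (spl2 S).

Lemma tors_tfree_null (X Y : P) (f : hom X Y) : tors X -> tfree Y -> null f.
Proof.
move=> /(proj1 h) hX /(proj2 h) hY.
have [Z [e [e' [ei ei']]]] := spl_eso (s1 Y) (s2 X).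
exists Z, (lift (inv ei ∘ fmap s1 f) (inv ei')), (lift e (fmap s2 f ∘ e')).
split; [|split].
- by apply/(proj1 h); apply: iso_initial (inv_iso ei') hX.
- by apply/(proj2 h); apply: iso_terminal (inv_iso ei) hY.
- apply: (spl_faithful (s := S)); rewrite fmapM ?lift1 ?lift2.
  + by rewrite cmpA invKV cmp1f.
  + by rewrite -cmpA invKV cmpf1.
Qed.

(** In [A × B] these are the sequences isomorphic to
    [(a, 0) -> (a, b) -> (1, b)].  If [r ∘ u] is null, the component of [u] in [B]
    factors through the initial object, hence through that of [T]; in [A] one
    lifts along the invertible [l].  The lift is unique because [0 -> b] is mono,
    and dually [a -> 1] is epi. *)
Lemma short_exact_of_splitting (T X F : P) (l : hom T X) (r : hom X F) :
  tors T -> tfree F -> is_iso (fmap s1 l) -> is_iso (fmap s2 r) -> short_exact l r.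
Proof.
move=> hT hF i1 i2; have n : null (r ∘ l) by apply: tors_tfree_null.
have {}hT := proj1 (proj1 h T) hT; have {}hF := proj1 (proj2 h F) hF.
split; split=> // W u [Z [g [k [/(proj1 h) hZ [/(proj2 h) hZ' e]]]]].
- have [j _] := initial_hom (s2 T) hZ.
  have ev : l ∘ lift (inv i1 ∘ fmap s1 u) (j ∘ fmap s2 g) = u.
  { apply: (spl_faithful (s := S)); rewrite fmapM ?lift1 ?lift2.
    + by rewrite cmpA invKV cmp1f.
    + apply: (iso_mono i2); rewrite -[RHS]fmapM e fmapM !cmpA.
      by congr cmp; apply: initial_uniq. }
  exists (lift (inv i1 ∘ fmap s1 u) (j ∘ fmap s2 g)); split=> // v' ev'.
  apply: (spl_faithful (s := S)).
  + by apply: (iso_mono i1); rewrite -!fmapM ev ev'.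
  + by apply: (initial_mono (f := fmap s2 l) (splB_bq S) hT); rewrite -!fmapM ev ev'.
- have [j _] := terminal_hom (s1 F) hZ'.
  have ev : lift (fmap s1 k ∘ j) (fmap s2 u ∘ inv i2) ∘ r = u.
  { apply: (spl_faithful (s := S)); rewrite fmapM ?lift1 ?lift2.
    + apply: (iso_epi i1); rewrite -[RHS]fmapM e fmapM -!cmpA.
      by congr cmp; apply: terminal_uniq.
    + by rewrite -cmpA invK cmpf1. }
  exists (lift (fmap s1 k ∘ j) (fmap s2 u ∘ inv i2)); split=> // v' ev'.
  apply: (spl_faithful (s := S)).
  + by apply: (terminal_epi (f := fmap s1 r) (splA_bq S) hF); rewrite -!fmapM ev ev'.
  + by apply: (iso_epi i2); rewrite -!fmapM ev ev'.
Qed.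

Lemma torsion_part_exists (X : P) : exists p : {T : P & hom T X},
  tors (projT1 p) /\ is_iso (fmap s1 (projT2 p)) /\
  (tors X -> arr (projT2 p) = arr (idn X)).
Proof.
have [hX|hX] := excluded_middle_informative (tors X).
- by exists (existT (fun T => hom T X) X (idn X)); rewrite fmap1; split=> //; split=> //; apply: iso_idn.
- have [b hb] := biqpointed_initial (splB_bq S).
  have [T [e [e' [ei ei']]]] := spl_eso (s1 X) b.
  have [k _] := initial_hom (s2 X) hb.
  exists (existT (fun T => hom T X) T (lift e (k ∘ e'))) => /=; rewrite lift1; split=> //.
  by apply/(proj1 h); apply: iso_initial (inv_iso ei') hb.
Qed.

Lemma tfree_part_exists (X : P) : exists p : {F : P & hom X F},
  tfree (projT1 p) /\ is_iso (fmap s2 (projT2 p)) /\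
  (tfree X -> arr (projT2 p) = arr (idn X)).
Proof.
have [hX|hX] := excluded_middle_informative (tfree X).
- by exists (existT (fun F => hom X F) X (idn X)); rewrite fmap1; split=> //; split=> //; apply: iso_idn.
- have [a ha] := biqpointed_terminal (splA_bq S).
  have [F [e [e' [ei ei']]]] := spl_eso a (s2 X).
  have [k _] := terminal_hom (s1 X) ha.
  exists (existT (fun F => hom X F) F (lift (inv ei ∘ k) (inv ei'))) => /=; rewrite lift2.
  split; last by split=> //; apply: inv_iso.
  by apply/(proj2 h); apply: iso_terminal (inv_iso ei) ha.
Qed.

End ShortExact.

Section PretorsionSplitting.
Variables (P : Pretorsion) (S : Splitting P).
Hypothesis h : splits S.
Local Notation s1 := (spl1 S).
Local Notation s2 := (spl2 S).

(** Short exact sequences with torsion and torsion-free ends are unique up to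
    isomorphism, and [short_exact_of_splitting] provides one with these two
    components invertible. *)
Lemma ses_splitting (T X F : P) (l : hom T X) (r : hom X F) :
  tors T -> tfree F -> short_exact l r -> is_iso (fmap s1 l) /\ is_iso (fmap s2 r).
Proof.
move=> hT hF e; have [[T' l'] [/= hT' [i1 _]]] := torsion_part_exists h X.
have [[F' r'] [/= hF' [i2 _]]] := tfree_part_exists h X.
have [i [j [ii [jj [<- <-]]]]] := ses_unique hT hF e.
have [i' [j' [ii' [jj' [el er]]]]] :=
  ses_unique hT' hF' (short_exact_of_splitting h hT' hF' i1 i2).
rewrite -el fmapM in i1; rewrite -er fmapM in i2.
rewrite !fmapM; split; apply: iso_cmp; try exact: iso_fmap.
- exact: iso_cancel_r (iso_fmap _ ii') i1.
- exact: iso_cancel_l (iso_fmap _ jj') i2.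
Qed.

Lemma ell_splitting (X : P) : is_iso (fmap s1 (ell X)).
Proof. exact: proj1 (ses_splitting (tors_obP X) (tfree_obP X) (pt_exact X)). Qed.

Lemma rho_splitting (X : P) : is_iso (fmap s2 (rho X)).
Proof. exact: proj2 (ses_splitting (tors_obP X) (tfree_obP X) (pt_exact X)). Qed.

(** In the first factor, [ind_T f] is [f] up to the isomorphisms [s1 (ell _)]; in
    the second, it is a map between initial objects. *)
Lemma ind_T_iso (X Y : P) (f : hom X Y) : is_iso (fmap s1 f) -> is_iso (ind_T f).
Proof.
move=> i; apply: (spl_reflect_iso (S := S)).
- apply: (iso_cancel_l (ell_splitting Y)); rewrite -fmapM ind_TP fmapM.
  by apply: iso_cmp i (ell_splitting X).
- by apply: initial_iso; apply/(proj1 h); apply: tors_obP.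
Qed.

Lemma ind_F_iso (X Y : P) (f : hom X Y) : is_iso (fmap s2 f) -> is_iso (ind_F f).
Proof.
move=> i; apply: (spl_reflect_iso (S := S)).
- by apply: terminal_iso; apply/(proj2 h); apply: tfree_obP.
- apply: (iso_cancel_r (rho_splitting X)); rewrite -fmapM ind_FP fmapM.
  by apply: iso_cmp (rho_splitting Y) i.
Qed.

Lemma splitting_rectangular : rectangular P.
Proof.
apply: equiv_of_ff_eso.
- move=> X Y [t f] /=.
  exists (lift (fmap s1 (ell Y) ∘ fmap s1 t ∘ inv (ell_splitting X))
               (inv (rho_splitting Y) ∘ fmap s2 f ∘ fmap s2 (rho X))).
  congr Pair; [apply: ind_T_uniq | apply: ind_F_uniq];
    apply: (spl_faithful (s := S)); rewrite !fmapM ?lift1 ?lift2.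
  + by rewrite -[RHS]cmpA invK cmpf1.
  + by apply: initial_uniq; apply: (proj1 (proj1 h _)); apply: tors_obP.
  + by apply: terminal_uniq; apply: (proj1 (proj2 h _)); apply: tfree_obP.
  + by rewrite !cmpA invKV cmp1f.
- move=> X Y f g [eT eF]; apply: (spl_faithful (s := S)).
  + apply: (iso_epi (ell_splitting X)); rewrite -!fmapM -!ind_TP.
    by rewrite eT.
  + apply: (iso_mono (rho_splitting Y)); rewrite -!fmapM -!ind_FP.
    by rewrite eF.
- move=> [[T hT] [F hF]].
  have [X [e [e' [ei ei']]]] := spl_eso (s1 T) (s2 F).
  have h2 := proj1 (proj1 h _) hT; have h2' := proj1 (proj1 h _) (tors_obP X).
  have h1 := proj1 (proj2 h _) hF; have h1' := proj1 (proj2 h _) (tfree_obP X).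
  have [b _] := initial_hom (s2 T) h2'; have [a _] := terminal_hom (s1 (tfree_ob X)) h1.
  exists X, (⟨lift (e ∘ fmap s1 (ell X)) b, lift a (e' ∘ inv (rho_splitting X))⟩ :
    @hom (FullSub (@tors P) × FullSub (@tfree P)) (Gamma P X) ⟨MkSub T hT, MkSub F hF⟩).
  apply: iso_pair; apply: (lift_iso (S := S)).
  + by apply: iso_cmp ei (ell_splitting X).
  + exact: initial_iso.
  + exact: terminal_iso.
  + by apply: iso_cmp ei' (inv_iso _).
Qed.
End PretorsionSplitting.

Section OfSplitting.
Variables (C : Category) (S : Splitting C).
Local Notation s1 := (spl1 S).
Local Notation s2 := (spl2 S).

Definition split_triple : Triple :=
  {| tcat := C; tors := fun X => initial (s2 X); tfree := fun X => terminal (s1 X) |}.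

Lemma split_triple_splits : @splits split_triple S.
Proof. by []. Qed.

Let torsion_sig X :=
  constructive_indefinite_description _ (torsion_part_exists split_triple_splits X).
Let tfree_sig X :=
  constructive_indefinite_description _ (tfree_part_exists split_triple_splits X).

Definition split_pretorsion : Pretorsion.
Proof.
refine {| pt := split_triple;
  tors_ob := fun X => projT1 (proj1_sig (torsion_sig X));
  tfree_ob := fun X => projT1 (proj1_sig (tfree_sig X));
  ell := fun X => projT2 (proj1_sig (torsion_sig X));
  rho := fun X => projT2 (proj1_sig (tfree_sig X));
  tors_obP := fun X => proj1 (proj2_sig (torsion_sig X));
  tfree_obP := fun X => proj1 (proj2_sig (tfree_sig X));
  ell_id := fun X => proj2 (proj2 (proj2_sig (torsion_sig X)));
  rho_id := fun X => proj2 (proj2 (proj2_sig (tfree_sig X))) |}.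
- abstract (by move=> X Y [f fi]; apply: iso_initial (iso_fmap s2 fi)).
- abstract (by move=> X Y [f fi]; apply: iso_terminal (iso_fmap s1 fi)).
- exact: (tors_tfree_null split_triple_splits).
- abstract (move=> X; have [hT [i1 _]] := proj2_sig (torsion_sig X);
    have [hF [i2 _]] := proj2_sig (tfree_sig X);
    exact: (short_exact_of_splitting split_triple_splits hT hF i1 i2)).
Defined.

Definition pairF : Functor C (splA S × splB S).
Proof.
refine {| fob := fun X => (⟨s1 X, s2 X⟩ : splA S × splB S);
          fmap := fun X Y f => ⟨fmap s1 f, fmap s2 f⟩ |}.
- abstract (by move=> X; rewrite !fmap1).
- abstract (by move=> X Y Z g f; rewrite !fmapM).
Defined.

Lemma pairF_equivalence : is_equivalence pairF.
Proof.
apply: equiv_of_ff_eso.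
- by move=> X Y [a b]; have [f [<- <-]] := spl_full a b; exists f.
- by move=> X Y f g [e1 e2]; apply: spl_faithful e1 e2.
- move=> [a b]; have [X [e [e' [ei ei']]]] := spl_eso a b.
  by exists X, (⟨e, e'⟩ : hom (pairF X) ⟨a, b⟩); apply: iso_pair.
Qed.

Lemma split_symmetrical : symmetrical split_pretorsion.
Proof.
exists (splA S), (splB S); split; [exact: splA_bq | split; [exact: splB_bq|]].
have [E' [n1 n2]] := pairF_equivalence.
exists pairF, E'; do 4![split=> //].
have [t ti] := n2; split=> Y [h1 h2] /=.
- exact: iso_initial (inv_iso (iso_p2 (ti Y))) h2.
- exact: iso_terminal (inv_iso (iso_p1 (ti Y))) h1.
Qed.

Definition split_sr : SRPretorsion :=
  {| sr := split_pretorsion;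
     sr_rectangular := splitting_rectangular (P := split_pretorsion) split_triple_splits;
     sr_symmetrical := split_symmetrical |}.
End OfSplitting.

Definition fstF (C D : Category) : Functor (C × D) C :=
  {| fob := fun X : C × D => p1 X; fmap := fun _ _ f => p1 f;
     fmap1 := fun _ => eq_refl; fmapM := fun _ _ _ _ _ => eq_refl |}.

Definition sndF (C D : Category) : Functor (C × D) D :=
  {| fob := fun X : C × D => p2 X; fmap := fun _ _ f => p2 f;
     fmap1 := fun _ => eq_refl; fmapM := fun _ _ _ _ _ => eq_refl |}.

Definition equiv_splitting (C A B : Category) (E : Functor C (A × B))
    (E' : Functor (A × B) C) (n1 : nat_iso (compF E' E) (idF C))
    (n2 : nat_iso (compF E E') (idF (A × B))) (hA : biqpointed A) (hB : biqpointed B) :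
  Splitting C.
Proof.
refine {| spl1 := compF (fstF A B) E; spl2 := compF (sndF A B) E;
          splA_bq := hA; splB_bq := hB |}.
- abstract (move=> X Y f g e1 e2; apply: (faithful_of_equiv n1); exact: (f_equal2 Pair e1 e2)).
- abstract (move=> X Y a b;
    have [f ef] := full_of_equiv n1 n2 (⟨a, b⟩ : hom (E X) (E Y)); exists f;
    split; [exact: (f_equal (@p1 _ _) ef) | exact: (f_equal (@p2 _ _) ef)]).
- abstract (move=> a b; have [t ti] := n2;
    exists (E' ⟨a, b⟩), (p1 (t ⟨a, b⟩)), (p2 (t ⟨a, b⟩));
    split; [exact: iso_p1 (ti ⟨a, b⟩) | exact: iso_p2 (ti ⟨a, b⟩)]).
Defined.

Lemma symmetrical_splits (P : Pretorsion) :
  symmetrical P -> exists S : Splitting P, splits S.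
Proof.
move=> [A [B [hA [hB [E [E' [n1 [n2 [pT [pF [qT qF]]]]]]]]]]].
exists (equiv_splitting n1 n2 hA hB); have [t ti] := n1.
have iso X : isomorphic (E' (E X)) X by exists (t X); apply: ti.
split=> X; split=> hX.
- exact: proj2 (pT _ hX).
- by apply: tors_replete (iso X) _; apply: qT.
- exact: proj1 (pF _ hX).
- by apply: tfree_replete (iso X) _; apply: qF.
Qed.

(** * Functors between pretorsion theories with splittings *)

Section PtFunctor.
Variables (P Q : Pretorsion) (S : Splitting P) (S' : Splitting Q).
Hypotheses (h : splits S) (h' : splits S').
Variable G : Functor P Q.
Hypotheses (bq : biqpointed P) (G01 : preserves01 G).

Lemma pt_functor_splitting : pt_functor G -> preserves_splitting S S' G.
Proof.
move=> [GT [GF Gses]]; split=> X Y f i.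
- have [iX _] := ses_splitting h' (GT _ (tors_obP X)) (GF _ (tfree_obP X)) (Gses X).
  have [iY _] := ses_splitting h' (GT _ (tors_obP Y)) (GF _ (tfree_obP Y)) (Gses Y).
  apply: (iso_cancel_r iX); rewrite -!fmapM -ind_TP !fmapM; apply: iso_cmp iY _.
  by do 2!apply: iso_fmap; apply: ind_T_iso h _ _ _ i.
- have [_ iX] := ses_splitting h' (GT _ (tors_obP X)) (GF _ (tfree_obP X)) (Gses X).
  have [_ iY] := ses_splitting h' (GT _ (tors_obP Y)) (GF _ (tfree_obP Y)) (Gses Y).
  apply: (iso_cancel_l iY); rewrite -!fmapM -ind_FP !fmapM; apply: iso_cmp _ iX.
  by do 2!apply: iso_fmap; apply: ind_F_iso h _ _ _ i.
Qed.

(** The converse of [pt_functor_splitting].  An object is torsion exactly if the map from [0] is invertible in the second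
    factor, and torsion-free exactly if the map to [1] is invertible in the
    first; hence both kinds of objects are preserved. *)
Lemma splitting_pt_functor : preserves_splitting S S' G -> pt_functor G.
Proof.
move=> [G1 G2].
have GT : forall X, tors X -> tors (G X).
  move=> X /(proj1 h) hX; apply/(proj1 h').
  have [O [_ [iO _]]] := bq.
  have [f _] := initial_hom X iO.
  apply: iso_initial (G2 _ _ f (initial_iso _ (proj2 (spl_initial S iO)) hX)) _.
  by apply: (proj2 (spl_initial S' _)); apply: (proj1 G01).
have GF : forall X, tfree X -> tfree (G X).
  move=> X /(proj2 h) hX; apply/(proj2 h').
  have [_ [T [_ [tT _]]]] := bq.
  have [f _] := terminal_hom X tT.
  apply: iso_terminal (inv_iso (G1 _ _ f (terminal_iso _ hX (proj1 (spl_terminal S tT))))) _.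
  by apply: (proj1 (spl_terminal S' _)); apply: (proj2 G01).
split=> //; split=> // X.
apply: (short_exact_of_splitting h' (GT _ (tors_obP X)) (GF _ (tfree_obP X))).
- by apply: G1; apply: ell_splitting.
- by apply: G2; apply: rho_splitting.
Qed.
End PtFunctor.

(** * The splitting of a pseudo-algebra and of a pretorsion theory *)

Lemma preserves_splitting_comp (C D E : Category) (S : Splitting C) (S' : Splitting D)
    (S'' : Splitting E) (G : Functor D E) (F : Functor C D) :
  preserves_splitting S' S'' G -> preserves_splitting S S' F ->
  preserves_splitting S S'' (compF G F).
Proof. by move=> [g1 g2] [f1 f2]; split=> X Y f i; [apply/g1/f1 | apply/g2/f2]. Qed.

Section AlgSplitting.
Variable A : PsAlg M_monad.

Let initial_sig := constructive_indefinite_description _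
  (biqpointed_initial (alg_biqpointed A)).

Definition alg_splitting : Splitting (bq_cat (pa_ob A)) :=
  band_splitting (alg_band A) (alg_biqpointed A) (proj2_sig initial_sig).

Lemma alg_splitting1 (X Y : bq_cat (pa_ob A)) (f : hom X Y) :
  is_iso (fmap (spl1 alg_splitting) f) <-> w1 (alg_band A) f.
Proof. exact: band_splitting1. Qed.

Lemma alg_splitting2 (X Y : bq_cat (pa_ob A)) (f : hom X Y) :
  is_iso (fmap (spl2 alg_splitting) f) <-> w2 (alg_band A) f.
Proof. exact: band_splitting2. Qed.
End AlgSplitting.

Section PsMorSplitting.
Variables A B : PsAlg M_monad.

Lemma psmor_preserves (f : PsMor A B) :
  preserves_splitting (alg_splitting A) (alg_splitting B) (sub_ob (pm_cell f)).
Proof.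
split=> X Y g.
- move=> /alg_splitting1 h; apply/alg_splitting1.
  exact: (bandmap_w1 (psmor_bandmap f)).
- move=> /alg_splitting2 h; apply/alg_splitting2.
  exact: (bandmap_w1 (mirror_map (psmor_bandmap f))).
Qed.

Variable G : hom2 (pa_ob A) (pa_ob B).
Hypothesis h : preserves_splitting (alg_splitting A) (alg_splitting B) (sub_ob G).

Lemma preserves_w1 (X Y : bq_cat (pa_ob A)) (f : hom X Y) :
  w1 (alg_band A) f -> w1 (alg_band B) (fmap (sub_ob G) f).
Proof. by move=> /alg_splitting1 i; apply/alg_splitting1; apply: (proj1 h). Qed.

Lemma preserves_w2 (X Y : bq_cat (pa_ob A)) (f : hom X Y) :
  w2 (alg_band A) f -> w2 (alg_band B) (fmap (sub_ob G) f).
Proof. by move=> /alg_splitting2 i; apply/alg_splitting2; apply: (proj2 h). Qed.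

Definition psmor_of_preserves : PsMor A B :=
  psmor_of_bandmap (bandmap_of_preserves
    (proj2_sig (constructive_indefinite_description _
       (biqpointed_initial (alg_biqpointed A)))) preserves_w1 preserves_w2).
End PsMorSplitting.

Lemma sr_splitting_exists (P : SRPretorsion) : exists S : Splitting P, splits S.
Proof. exact: symmetrical_splits (sr_symmetrical P). Qed.

Definition sr_splitting (P : SRPretorsion) : Splitting (bq_cat (sr_cat P)) :=
  proj1_sig (constructive_indefinite_description _ (sr_splitting_exists P)).

Lemma sr_splits (P : SRPretorsion) : @splits P (sr_splitting P).
Proof. exact: proj2_sig. Qed.

Definition sr_alg (P : SRPretorsion) : PsAlg M_monad := split_alg (C := sr_cat P) (sr_splitting P).

Definition alg_sr (A : PsAlg M_monad) : SRPretorsion := split_sr (alg_splitting A).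

Lemma alg_sr_splits (A : PsAlg M_monad) : @splits (alg_sr A) (alg_splitting A).
Proof. by []. Qed.

(** Making a pseudo-algebra of a splitting and then a splitting of it preserves the
    two classes of morphisms, since [rect_map f (idn _)] is [f] in the first factor
    and an identity in the second, up to isomorphism. *)
Lemma sr_alg_splitting1 (P : SRPretorsion) (X Y : P) (f : hom X Y) :
  is_iso (fmap (spl1 (alg_splitting (sr_alg P))) f)
  <-> is_iso (fmap (spl1 (sr_splitting P)) f).
Proof.
split.
- move=> /(alg_splitting1 (A := sr_alg P)) i.
  exact: (proj1 (@rect_map_iso1 (sr_cat P) (sr_splitting P) _ _ X f) (i X)).
- move=> i; apply/(alg_splitting1 (A := sr_alg P)) => Z.
  exact: (proj2 (@rect_map_iso1 (sr_cat P) (sr_splitting P) _ _ Z f) i).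
Qed.

Lemma sr_alg_splitting2 (P : SRPretorsion) (X Y : P) (f : hom X Y) :
  is_iso (fmap (spl2 (alg_splitting (sr_alg P))) f)
  <-> is_iso (fmap (spl2 (sr_splitting P)) f).
Proof.
split.
- move=> /(alg_splitting2 (A := sr_alg P)) i.
  exact: (proj1 (@rect_map_iso2 (sr_cat P) (sr_splitting P) X _ _ f) (i X)).
- move=> i; apply/(alg_splitting2 (A := sr_alg P)) => Z.
  exact: (proj2 (@rect_map_iso2 (sr_cat P) (sr_splitting P) Z _ _ f) i).
Qed.

Lemma sr_to_alg_id (P : SRPretorsion) :
  preserves_splitting (sr_splitting P) (alg_splitting (sr_alg P)) (idF P).
Proof. by split=> X Y f i; [apply/sr_alg_splitting1 | apply/sr_alg_splitting2]. Qed.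

Lemma alg_to_sr_id (P : SRPretorsion) :
  preserves_splitting (alg_splitting (sr_alg P)) (sr_splitting P) (idF P).
Proof. by split=> X Y f i; [apply/sr_alg_splitting1 | apply/sr_alg_splitting2]. Qed.

Lemma splits_id (P : SRPretorsion) (S S' : Splitting P) :
  splits S -> splits S' -> preserves_splitting S S' (idF P).
Proof. by move=> h h'; apply: (pt_functor_splitting h h'); apply: pt_functor_id. Qed.

(** * The 2-functors *)

Definition sr_alg_mor (P Q : SRPretorsion) (G : @hom2 PTorSR P Q) :
  PsMor (sr_alg P) (sr_alg Q).
Proof.
refine (@psmor_of_preserves (sr_alg P) (sr_alg Q) (sub_ob G) _).
abstract (exact: (preserves_splitting_comp (@sr_to_alg_id Q)
  (preserves_splitting_comp
    (pt_functor_splitting (@sr_splits P) (@sr_splits Q) (sub_in G)) (@alg_to_sr_id P)))).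
Defined.

Definition sr_alg_hom (P Q : SRPretorsion) :
  Functor (@hom2 PTorSR P Q) (PsHom (sr_alg P) (sr_alg Q)).
Proof.
refine {| fob := fun G : @hom2 PTorSR P Q => sr_alg_mor G : PsHom (sr_alg P) (sr_alg Q);
  fmap := fun (F G : @hom2 PTorSR P Q) (s : hom F G) =>
    (MkPsCell (psmor_2cell (f := sr_alg_mor F) (g := sr_alg_mor G) s)
     : @hom (PsHom _ _) (sr_alg_mor F) (sr_alg_mor G)) |}.
- abstract (by move=> G; apply: pc_eq).
- abstract (by move=> F G H t s; apply: pc_eq).
Defined.

Definition sr_algF : TwoFunctor PTorSR (PsAlgCat M_monad).
Proof.
refine {| f2ob := sr_alg : PTorSR -> PsAlgCat M_monad; f2hom := sr_alg_hom |}.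
- abstract (by move=> P; apply: psmor_uniq).
- abstract (by move=> P Q R G G' F F' t s; apply: arr_pc => //; apply: psmor_uniq).
Defined.

Definition alg_sr_mor (A B : PsAlg M_monad) (f : PsMor A B) :
  @hom2 PTorSR (alg_sr A) (alg_sr B).
Proof.
refine (@MkSub _ _ (pm_cell f : @hom2 BiQPointCat (sr_cat (alg_sr A)) (sr_cat (alg_sr B))) _).
abstract (exact: (splitting_pt_functor (@alg_sr_splits A) (@alg_sr_splits B)
  (alg_biqpointed A) (sub_in (pm_cell f)) (psmor_preserves f))).
Defined.

Definition alg_sr_hom (A B : PsAlg M_monad) :
  Functor (PsHom A B) (@hom2 PTorSR (alg_sr A) (alg_sr B)).
Proof.
refine {| fob := fun f : PsHom A B => alg_sr_mor f;
  fmap := fun (f g : PsHom A B) (s : hom f g) =>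
    (pc_cell s : @hom (@hom2 PTorSR (alg_sr A) (alg_sr B)) (alg_sr_mor f) (alg_sr_mor g)) |}.
- abstract (by []).
- abstract (by []).
Defined.

Definition alg_srF : TwoFunctor (PsAlgCat M_monad) PTorSR.
Proof.
refine {| f2ob := alg_sr : PsAlgCat M_monad -> PTorSR; f2hom := alg_sr_hom |}.
- abstract (by move=> A; apply: sub_eq).
- abstract (by move=> A B C g g' f f' t s; apply: arr_sub).
Defined.

(** * Equality of 2-functors *)

(** 2-cells together with the objects they live over, so that they can be compared
    before those objects are known to be the same. *)
Definition total2 (K : TwoCat) (A B : K) (x : Arr (hom2 A B)) :
  {A : K & {B : K & Arr (hom2 A B)}} := existT _ A (existT _ B x).

Lemma two_functor_eq (K L : TwoCat) (F G : TwoFunctor K L) :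
  (forall (A B : K) (f g : hom2 A B) (s : hom f g),
     total2 (arr (F @2 s)) = total2 (arr (G @2 s))) -> F = G.
Proof.
case: F G => [F Fh F1 FM] [G Gh G1 GM] /= e.
have eo : F = G.
  apply: functional_extensionality => A.
  exact: (f_equal (@projT1 _ _) (e A A (id1 A) (id1 A) (idn _))).
subst G.
have eh : Fh = Gh.
  apply: functional_extensionality_dep => A.
  apply: functional_extensionality_dep => B.
  apply: functor_eq => f g s.
  exact: (inj_pair2 _ _ _ _ _ (inj_pair2 _ _ _ _ _ (e A B f g s))).
by subst Gh; f_equal; apply: proof_irrelevance.
Qed.

(** The proof of bi-quasi-pointedness that [sr_cat] attaches to a category may
    differ from the given one, so objects of [BiQPointCat] with the same
    category have to be identified by proof irrelevance. *)
Lemma total2_biqp (C D : Category) (p p' : biqpointed C) (q q' : biqpointed D)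
    (x : Arr (@hom2 BiQPointCat (Build_BiQP p) (Build_BiQP q))) :
  total2 x = @total2 BiQPointCat (Build_BiQP p') (Build_BiQP q') x.
Proof. by rewrite (proof_irrelevance _ p' p) (proof_irrelevance _ q' q). Qed.

Lemma cell1_biqp (C D : Category) (p p' : biqpointed C) (q q' : biqpointed D)
    (x : @hom2 BiQPointCat (Build_BiQP p) (Build_BiQP q)) :
  cell1 x = @cell1 BiQPointCat (Build_BiQP p') (Build_BiQP q') x.
Proof. by rewrite (proof_irrelevance _ p' p) (proof_irrelevance _ q' q). Qed.

Lemma sr_algF_over : comp2F (PsForget M_monad) sr_algF = PTorSR_forget.
Proof. by apply: two_functor_eq. Qed.

Lemma alg_srF_over : comp2F PTorSR_forget alg_srF = PsForget M_monad.
Proof. apply: two_functor_eq => A B f g s; exact: total2_biqp. Qed.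

(** * The 2-natural isomorphisms *)

Definition sr_unit_cell (P : SRPretorsion) : @hom2 PTorSR P (alg_sr (sr_alg P)).
Proof.
refine (@MkSub _ _ (id1 (sr_cat P) :
  @hom2 BiQPointCat (sr_cat P) (sr_cat (alg_sr (sr_alg P)))) _).
abstract (exact: (splitting_pt_functor (@sr_splits P) (@alg_sr_splits (sr_alg P))
  (sr_biqpointed P) (preserves01_id P) (@sr_to_alg_id P))).
Defined.

Definition sr_unit_inv (P : SRPretorsion) : @hom2 PTorSR (alg_sr (sr_alg P)) P.
Proof.
refine (@MkSub _ _ (id1 (sr_cat P) :
  @hom2 BiQPointCat (sr_cat (alg_sr (sr_alg P))) (sr_cat P)) _).
abstract (exact: (splitting_pt_functor (@alg_sr_splits (sr_alg P)) (@sr_splits P)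
  (sr_biqpointed P) (preserves01_id P) (@alg_to_sr_id P))).
Defined.

Definition sr_unit : TwoNat (id2F PTorSR) (comp2F alg_srF sr_algF).
Proof.
refine {| tnc := sr_unit_cell : forall P : PTorSR,
  hom2 (id2F PTorSR P) (comp2F alg_srF sr_algF P) |}.
abstract (move=> P Q F G s; apply: arr_sub;
  apply: (@arr_2cell (sr_cat P) (sr_cat (alg_sr (sr_alg Q)))) => // X;
  by rewrite /= fmap1 cmp1f cmpf1).
Defined.

Lemma sr_unit_iso : two_nat_iso sr_unit.
Proof.
by move=> P; exists (sr_unit_inv P); split; apply: sub_eq; apply: sub_eq; apply: functor_eq.
Qed.

Lemma alg_to_alg_id (A : PsAlg M_monad) :
  preserves_splitting (alg_splitting (sr_alg (alg_sr A))) (alg_splitting A)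
    (idF (bq_cat (pa_ob A))).
Proof.
exact: (preserves_splitting_comp (splits_id (@sr_splits (alg_sr A)) (@alg_sr_splits A))
  (@alg_to_sr_id (alg_sr A))).
Qed.

Lemma alg_from_alg_id (A : PsAlg M_monad) :
  preserves_splitting (alg_splitting A) (alg_splitting (sr_alg (alg_sr A)))
    (idF (bq_cat (pa_ob A))).
Proof.
exact: (preserves_splitting_comp (@sr_to_alg_id (alg_sr A))
  (splits_id (@alg_sr_splits A) (@sr_splits (alg_sr A)))).
Qed.

Definition alg_counit_cell (A : PsAlg M_monad) : PsMor (sr_alg (alg_sr A)) A :=
  @psmor_of_preserves (sr_alg (alg_sr A)) A (id1 (pa_ob A)) (alg_to_alg_id A).

Definition alg_counit_inv (A : PsAlg M_monad) : PsMor A (sr_alg (alg_sr A)) :=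
  @psmor_of_preserves A (sr_alg (alg_sr A)) (id1 (pa_ob A)) (alg_from_alg_id A).

Definition alg_counit : TwoNat (comp2F sr_algF alg_srF) (id2F (PsAlgCat M_monad)).
Proof.
refine {| tnc := alg_counit_cell : forall A : PsAlgCat M_monad,
  hom2 (comp2F sr_algF alg_srF A) (id2F (PsAlgCat M_monad) A) |}.
move=> A B f g s; apply: arr_pc.
- by apply: psmor_uniq; apply: sub_eq; apply: functor_eq.
- by apply: psmor_uniq; apply: sub_eq; apply: functor_eq.
- apply: (@arr_2cell (pa_ob A) (pa_ob B)) => // X.
  by rewrite /= fmap1 cmp1f cmpf1.
Defined.

Lemma alg_counit_iso : two_nat_iso alg_counit.
Proof.
move=> A; exists (alg_counit_inv A : @hom2 (PsAlgCat M_monad) A (sr_alg (alg_sr A))).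
by split; apply: psmor_uniq; apply: sub_eq; apply: functor_eq.
Qed.

Theorem theorem3p11 : two_equivalent_over PTorSR_forget (PsForget M_monad).
Proof.
exists sr_algF, alg_srF, sr_unit, alg_counit.
split; [exact: sr_algF_over | split; [exact: alg_srF_over |]].
split; [exact: sr_unit_iso | split; [exact: alg_counit_iso |]].
by split=> [P|A]; apply: cell1_biqp.
Qed.
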